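(* Let $S\subseteq[n_1]\times\dots\times[n_k]$ with corresponding matrix $\mathcal{A}_S$ and $k$-way quasi-independence model $\mathcal{M}_S$. If there exist distinct $a,b\in[k]$ and $\mathbf{i}\in N_{ab}$ such that the $2$-way quasi-independence model specified by $S_{a,b}^{\mathbf{i}}$ has ML-degree greater than $1$, then $\mathcal{M}_S$ also has ML-degree greater than $1$.
   Context: **Quasi-independence model.** For a set $S\subseteq[n_1]\times\dots\times[n_k]$, $\mathcal{A}_S$ is the $0/1$ matrix with columns indexed by $S$ and $k$ blocks of rows, the $j$th block having rows indexed by $[n_j]$, where the column of $(i_1,\dots,i_k)$ has in block $j$ exactly one $1$, in row $i_j$. The model $\mathcal{M}_S$ is the set of positive probability vectors $p\in\mathbb{R}^S$ with $\log p\in\mathrm{rowspan}(\mathcal{A}_S)$ (equivalently, parametrized by $p_{i_1\cdots i_k}=\prod_j s^j_{i_j}$). **Slices.** For distinct $a,b\in[k]$, $N_{ab}=\prod_{j\ne a,b}[n_j]$. For $\mathbf{i}\in N_{ab}$ and $(s,t)\in[n_a]\times[n_b]$, $\mathbf{i}+(s,t)\in[n_1]\times\dots\times[n_k]$ is the vector whose $j$th coordinate is $i_j$ if $j\neq a,b$, $s$ if $j=a$, and $t$ if $j=b$. Define $S_{a,b}^{\mathbf{i}}=\{(s,t)\in[n_a]\times[n_b] : \mathbf{i}+(s,t)\in S\}$. **ML-degree.** The ML-degree of a model is the number of complex critical points, counted with multiplicity, of the log-likelihood function $\sum_s u_s\log p_s$, for generic data $u$, on the part of the complex Zariski closure of the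 model with $\sum_s p_s=1$ and all $p_s\neq0$. For $\mathcal{M}_S$ these are the points $p$ there with $\mathcal{A}_Su=u_+\mathcal{A}_Sp$, $u_+=\sum_s u_s$. *)

(* Defs.v *)
From HB Require Import structures.
From mathcomp Require Import all_boot all_order all_algebra.
From mathcomp Require Import complex mpoly.
From mathcomp Require Import reals.
From mathcomp Require exp.

Set Implicit Arguments.
Unset Strict Implicit.
Unset Printing Implicit Defensive.

Import Order.TTheory GRing.Theory Num.Theory.
Local Open Scope ring_scope.

Notation cells n := {dffun forall j, 'I_(n j)}.

Section QuasiIndependence.
Variables (k : nat) (n : 'I_k -> nat) (S : {set cells n}).

(* R^S is 'rV[R]_#|S|, coordinate c standing for the cell enum_val c. The row  *)
(* of A_S in block j with label i in [n_j] is the one numbered by Tagged _ i.  *)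
Definition qi_mx (F : pzRingType) :
    'M[F]_(#|{: {j : 'I_k & 'I_(n j)}}|, #|S|) :=
  \matrix_(r, c) ((enum_val c : cells n) (tag (enum_val r)) == tagged (enum_val r))%:R.

Variable R : realType.
Local Notation C := (complex R).

Definition qi_model (p : 'rV[R]_#|S|) : Prop :=
  [/\ forall c, 0 < p 0 c, \sum_c p 0 c = 1
    & (map_mx (@exp.ln R) p <= qi_mx R)%MS].

(* The ideal of complex polynomials vanishing on the model, and its zero set,  *)
(* the complex Zariski closure of the model.                                  *)
Definition qi_ideal (f : {mpoly C[#|S|]}) : Prop :=
  forall p, qi_model p -> f.@[map_mx (real_complex R) p 0] = 0.

Definition qi_closure (p : 'rV[C]_#|S|) : Prop :=
  forall f, qi_ideal f -> f.@[p 0] = 0.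

Definition total (u : 'rV[C]_#|S|) : C := \sum_c u 0 c.

Definition critical (u p : 'rV[C]_#|S|) : Prop :=
  [/\ qi_closure p, total p = 1, forall c, p 0 c != 0
    & qi_mx C *m u^T = total u *: (qi_mx C *m p^T)].

(* The entries of A_S u - u_+ A_S x, as polynomials in x.                      *)
Definition likelihood_eq (u : 'rV[C]_#|S|) r : {mpoly C[#|S|]} :=
  ((qi_mx C *m u^T) r 0)%:MP - total u *: \sum_c qi_mx C r c *: 'X_c.

(* The ideal of the scheme of critical points, before removing the coordinate  *)
(* hyperplanes. The equation sum_s p_s = 1 already belongs to qi_ideal.        *)
Definition critical_ideal (u : 'rV[C]_#|S|) (f : {mpoly C[#|S|]}) : Prop :=
  exists2 g, qi_ideal g & exists q, f = g + \sum_r q r * likelihood_eq u r.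

End QuasiIndependence.

(* The multiplicity of the ideal J at the point p is d: the local ring         *)
(* C[x]_p / J C[x]_p has dimension d over C. Its elements are the fractions    *)
(* f / g with g(p) <> 0, and f / g vanishes in it iff h f \in J for some h     *)
(* with h(p) <> 0. A common denominator of a basis is a unit of that ring, so  *)
(* the basis b may be taken to consist of polynomials.                         *)
Definition has_multiplicity (F : fieldType) (m : nat) (J : {mpoly F[m]} -> Prop)
    (p : 'rV[F]_m) (d : nat) : Prop :=
  exists b : 'I_d -> {mpoly F[m]},
  forall f g : {mpoly F[m]}, g.@[p 0] != 0 ->
  exists! c : 'rV[F]_d, exists2 h : {mpoly F[m]}, h.@[p 0] != 0 &
    J (h * (f - g * \sum_i c 0 i *: b i)).

(* Generic data are those off the zero set of some nonzero polynomial h.       *)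
Definition has_ml_degree (R : realType) (k : nat) (n : 'I_k -> nat)
    (S : {set cells n}) (d : nat) : Prop :=
  exists2 h : {mpoly (complex R)[#|S|]}, h != 0 &
  forall u : 'rV[complex R]_#|S|, h.@[u 0] != 0 ->
  exists (s : seq 'rV[complex R]_#|S|) (mu : 'rV[complex R]_#|S| -> nat),
    [/\ uniq s, forall p, p \in s <-> critical u p,
        forall p, p \in s -> has_multiplicity (critical_ideal u) p (mu p)
      & d = (\sum_(p <- s) mu p)%N].

Definition slice_size (k : nat) (n : 'I_k -> nat) (a b : 'I_k) (l : 'I_2) : nat :=
  n (tnth [tuple a; b] l).

(* The slice as a two-way subset of [n_a] x [n_b], in that order: (s, t) is in *)
(* it iff the cell with coordinates s at a, t at b, and i elsewhere is in S.   *)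
Definition slice (k : nat) (n : 'I_k -> nat) (S : {set cells n}) (a b : 'I_k)
    (i : forall j : {j : 'I_k | (j != a) && (j != b)}, 'I_(n (val j))) :
    {set cells (slice_size n a b)} :=
  [set c : cells (slice_size n a b) |
    [exists x in S, [forall l, x (tnth [tuple a; b] l) == c l]
                 && [forall j, x (val j) == i j]]].

(* Main.v *)
Require Import Defs.
From HB Require Import structures.
From mathcomp Require Import all_boot all_order all_algebra.
From mathcomp Require Import complex mpoly generic_quotient.
From mathcomp Require Import boolp reals.
From mathcomp Require sequences exp separable.
From mathcomp Require Import ring.

(* Put A = A_S and let p(s) be the monomial parametrization of the cone over the
   model, so that b = A p(s) is its moment map. A critical point for u, multiplied
   by u_+, is a point of the cone above A u. The Jacobian E diag(p) E^T of b, for a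
   row basis E of A, is invertible, and a count of monomials makes every p_c
   algebraic over C(b); a primitive element theta of C(p) over C(b) then identifies
   the critical points for generic u with the roots of the specialized minimal
   polynomial of theta, all simple. Hence the ML-degree is [C(p) : C(b)], and it is
   at most 1 iff every p_c is a rational function of b.

   Rationality passes to faces: let F be the face of cells with a prescribed
   coordinate j, scale the parameters of the other labels of j by eps, and compare
   the lowest order terms in eps of p_c D(b) = Q(b) for c in F. On the rows of A that
   vanish on F, b is of order eps, and its leading term is algebraically independent
   over the p_d with d in F, so a coefficient of the lowest order terms already
   expresses p_c through the moment map of F. Fixing all coordinates except a and b
   in turn gives the slice. *)

Set Implicit Arguments.
Unset Strict Implicit.
Unset Printing Implicit Defensive.

Import Order.TTheory GRing.Theory Num.Theory.
Local Open Scope ring_scope.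

(** * Multivariate polynomials *)

(** The two ends of the argument are used asymmetrically. For the slice it is enough that
    rationality bounds every ML-degree by 1; for S a degree has to be produced, and the converse
    implication comes with it. So it is non-rationality that passes from the slice to S. Putting eps
    = 0 in p_c D(b) = Q(b) may give 0 = 0, since D can vanish on the moment image of the face. This
    is why D and Q are expanded in the coordinates of b that vanish on the face. Comparing
    coefficients then requires independence over a ring of non-constant functions, so the Jacobian
    criterion is stated relative to elements killed by derivations: here Euler derivations that kill
    every monomial of the face. Relations over C(b) must survive the specialization of b to A u.
    They are kept as identities over the polynomial ring, by pseudo-division and cleared
    denominators, and u is generic when the finitely many denominators, leading coefficients and
    Bezout constants do not vanish. Multiplicities concern the ideal and not only its zeros, so
    identities are needed both at the critical points and modulo the critical ideal. *)

Section MpolyMorphisms.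
Variables (n : nat) (R : comNzRingType).

Lemma rmorph_mmap (S T : comNzRingType) (f : {rmorphism R -> S})
    (g : {rmorphism S -> T}) (h : 'I_n -> S) p :
  g (mmap f h p) = mmap (g \o f) (g \o h) p.
Proof.
rewrite /mmap rmorph_sum /=; apply: eq_bigr => m _.
by rewrite rmorphM /= rmorph_prod; congr (_ * _); apply: eq_bigr => i _; rewrite rmorphXn.
Qed.

Lemma eq_mmap (S : comNzRingType) (f g : R -> S) (h k : 'I_n -> S) p :
  f =1 g -> h =1 k -> mmap f h p = mmap g k p.
Proof.
move=> fg hk; apply: eq_bigr => m _; rewrite fg; congr (_ * _).
by apply: eq_bigr => i _; rewrite hk.
Qed.

Lemma meval_map_mpoly (S : comNzRingType) (f : {rmorphism R -> S}) (h : 'I_n -> S) p :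
  (map_mpoly f p).@[h] = mmap f h p.
Proof.
rewrite /map_mpoly (rmorph_mmap _ (meval h)).
by apply: eq_mmap => [x|i] /=; rewrite ?mevalC ?mevalXU.
Qed.

Lemma rmorph_mpolyE (S : comNzRingType) (g : {rmorphism {mpoly R[n]} -> S}) p :
  g p = mmap (g \o @mpolyC n R) (fun i => g 'X_i) p.
Proof.
elim/mpolyind: p => [|c m p _ _ IH]; first by rewrite !rmorph0.
rewrite !rmorphD /= IH -mul_mpolyC !rmorphM /= mmapC mmapX /=.
congr (_ * _ + _); rewrite mpolyXE_id rmorph_prod.
by apply: eq_bigr => i _; rewrite rmorphXn.
Qed.

End MpolyMorphisms.

Section NonvanishingPoint.
Variable F : numDomainType.

(** Positive integers are chosen so that the resulting points and scaling factors are positive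
    reals, as the cone requires. *)
Lemma poly_neq0_pt (p : {poly F}) : p != 0 ->
  exists k : nat, p.[k.+1%:R] != 0.
Proof.
move=> p0; apply: contrapT => H.
have /(max_poly_roots p0) : all (root p) [seq (i.+1)%:R | i <- iota 0 (size p)].
  apply/allP => x /mapP[i _ ->]; apply/negPn/negP => H2; apply: H.
  by exists i.
rewrite map_inj_uniq ?iota_uniq; last by move=> i j /eqP; rewrite eqr_nat => /eqP[].
by move=> /(_ isT); rewrite size_map size_iota ltnn.
Qed.

Lemma digits_inj n K (f g : 'I_n -> nat) :
  (forall i, (f i < K)%N) -> (forall i, (g i < K)%N) ->
  (\sum_i f i * K ^ i = \sum_i g i * K ^ i)%N -> f =1 g.
Proof.
elim: n f g => [|n IH] f g fK gK; first by move=> _ [].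
have rec h : (\sum_(i < n.+1) h i * K ^ i =
    (\sum_(i < n) h (lift ord0 i) * K ^ i) * K + h ord0)%N.
  rewrite big_ord_recl expn0 muln1 addnC big_distrl /=; congr (_ + _)%N.
  by apply: eq_bigr => i _; rewrite /bump add1n expnSr mulnA.
rewrite !rec => e.
have K0 : (0 < K)%N by exact: leq_ltn_trans (fK ord0).
have e0 : f ord0 = g ord0.
  by have := congr1 (modn^~ K) e; rewrite !modnMDl !modn_small.
have e1 : f \o lift ord0 =1 g \o lift ord0.
  apply: IH => [i|i|] /=; [exact: fK|exact: gK|].
  by move/eqP: e; rewrite e0 eqn_add2r eqn_pmul2r // => /eqP.
move=> i; case: (unliftP ord0 i) => [j ->|->//]; exact: e1.
Qed.

(* Kronecker substitution X_i := t ^ (K ^ i) keeps the monomials distinct. *)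
Lemma mpoly_neq0_pt n (p : {mpoly F[n]}) : p != 0 ->
  exists2 v : 'I_n -> nat, (forall i, (0 < v i)%N) & p.@[fun i => (v i)%:R] != 0.
Proof.
move=> p0; pose K := msize p; pose kap (m : 'X_{1..n}) := (\sum_i m i * K ^ i)%N.
pose q := mmap (@polyC F) (fun i : 'I_n => 'X^(K ^ i)) p.
have mmap1q (m : 'X_{1..n}) : mmap1 (fun i : 'I_n => 'X^(K ^ i) : {poly F}) m = 'X^(kap m).
  rewrite /mmap1 /kap -prodrXr; apply: eq_bigr => i _.
  by rewrite -exprM mulnC.
have bd m : m \in msupp p -> forall i, (m i < K)%N.
  move=> /msize_mdeg_lt mK i; apply: leq_ltn_trans mK.
  by rewrite mdegE (bigD1 i) //= leq_addr.
have qk : q`_(kap (mlead p)) = mleadc p.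
  rewrite /q /mmap coef_sum (bigD1_seq (mlead p)) ?msupp_uniq ?mlead_supp //=.
  rewrite mmap1q coefCM coefXn eqxx mulr1 big_seq_cond big1 ?addr0 // => m /andP[mp mn].
  rewrite mmap1q coefCM coefXn; case: eqP => [e|]; last by rewrite mulr0.
  case/eqP: mn; apply/mnmP; apply: (digits_inj (bd _ mp)) => //.
  exact/bd/mlead_supp.
have /poly_neq0_pt[k qk0] : q != 0.
  by apply/eqP => q0; move: qk; rewrite q0 coef0 => /esym/eqP; rewrite mleadc_eq0 (negPf p0).
exists (fun i => k.+1 ^ (K ^ i))%N; first by move=> i; rewrite expn_gt0.
apply: contraNneq qk0 => H.
apply/eqP; rewrite -[RHS]H /q /mmap horner_sum mevalE; apply: eq_bigr => m _.
rewrite hornerM hornerC /mmap1 horner_prod; congr (_ * _).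
by apply: eq_bigr => i _; rewrite horner_exp hornerXn natrX.
Qed.

End NonvanishingPoint.

(* Jacobian criterion, relative to the constants of the derivations [D]. *)
Section Independence.
Variables (A : idomainType) (r : nat) (D : 'I_r -> A -> A) (q : 'I_r -> A).
Hypothesis A_char0 : forall k, k.+1%:R != 0 :> A.
Hypothesis D_add : forall i, {morph D i : x y / x + y}.
Hypothesis D_mul : forall i x y, D i (x * y) = D i x * y + x * D i y.
Hypothesis jac : \det (\matrix_(i, j) D i (q j)) != 0.

Let killed (f : {mpoly A[r]}) := forall m i, D i f@_m = 0.

Let D0 i : D i 0 = 0.
Proof. by apply/(addrI (D i 0)); rewrite -D_add !addr0. Qed.

Let D1 i : D i 1 = 0.
Proof. by apply/(addrI (D i 1)); rewrite addr0 -{3}[1]mulr1 D_mul mul1r mulr1. Qed.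

Let D_sum i (I : Type) (s : seq I) (F : I -> A) :
  D i (\sum_(j <- s) F j) = \sum_(j <- s) D i (F j).
Proof. exact: (big_morph (D i) (D_add i) (D0 i)). Qed.

Let D_exp i x n : D i (x ^+ n) = x ^+ n.-1 * D i x *+ n.
Proof.
case: n => [|n]; first by rewrite expr0 D1 mulr0n.
elim: n => [|n IH]; first by rewrite expr1 mul1r mulr1n.
rewrite exprS D_mul IH /= mulrnAr mulrA -exprS [in RHS]mulrS; congr (_ + _).
by rewrite mulrC.
Qed.

Let D_monom i (m : 'X_{1..r}) :
  D i (\prod_j q j ^+ m j) =
  \sum_j (\prod_l q l ^+ (m - U_(j))%MM l) *+ m j * D i (q j).
Proof.
have D_prod (s : seq 'I_r) (F : 'I_r -> A) : uniq s ->
  D i (\prod_(j <- s) F j) = \sum_(j <- s) (\prod_(l <- s | l != j) F l) * D i (F j).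
  elim: s => [|a s IH]; first by rewrite !big_nil D1.
  move=> /= /andP[as_ us]; rewrite !big_cons D_mul IH //= eqxx.
  congr (_ + _); first by
    rewrite mulrC; congr (_ * _); rewrite big_seq [RHS]big_seq_cond; apply: eq_bigl => l;
    case: (boolP (l \in s)) => //= ls; apply/esym; apply: contraNneq as_ => <-.
  rewrite mulr_sumr big_seq [RHS]big_seq; apply: eq_bigr => j js.
  rewrite big_cons; case: eqP => [e|_]; last by rewrite mulrA.
  by move: as_; rewrite e js.
rewrite D_prod ?index_enum_uniq //; apply: eq_bigr => j _.
rewrite D_exp mulrnAr mulrnAl mulrA; congr (_ * _ *+ _).
rewrite [in RHS](bigD1 j) //= mnmBE mnm1E eqxx subn1 mulrC; congr (_ * _).
apply: eq_bigr => l lj; rewrite mnmBE mnm1E eq_sym (negPf lj) subn0 //.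
Qed.

Let chain i f : killed f -> D i f.@[q] = \sum_j (f^`M(j)).@[q] * D i (q j).
Proof.
move=> kf; rewrite mevalE D_sum.
under eq_bigr => m _ do rewrite D_mul kf mul0r add0r D_monom mulr_sumr.
rewrite exchange_big /=; apply: eq_bigr => j _.
have -> : f^`M(j) = \sum_(m <- msupp f) f@_m *: ('X_[m])^`M(j).
  rewrite {1}[f]mpolyE raddf_sum; apply: eq_bigr => m _; exact: mderivZ.
rewrite (big_morph (meval q) (mevalD q) (meval0 q)) mulr_suml; apply: eq_bigr => m _.
by rewrite mderivX /= !mevalZ mevalX -!mulrA -mulr_natl -!mulrA.
Qed.

(** Induction on the size of [f]. Applying [D i] to f(q) = 0 gives, by the chain rule, a linear
    system with the Jacobian as matrix for the values at [q] of the partial derivatives of [f].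
    These values therefore vanish, so the partial derivatives, being smaller, are zero, and in
    characteristic 0 [f] is constant. *)
Lemma jacobian_indep (f : {mpoly A[r]}) :
  (forall m i, D i f@_m = 0) -> f.@[q] = 0 -> f = 0.
Proof.
have [n] := ubnP (msize f); elim: n f => // n IH f fn kf fq.
have df j : f^`M(j) = 0.
  have [//|d0] := eqVneq (f^`M(j)) 0; apply: IH.
  - rewrite ltnS in fn; apply: leq_trans fn; rewrite -(mlead_deg d0).
    have := mlead_supp d0; rewrite mcoeff_msupp mcoeff_deriv => H.
    have : (mlead f^`M(j) + U_(j))%MM \in msupp f.
      by rewrite mcoeff_msupp; apply: contraNneq H => ->; rewrite mul0rn.
    by move=> /msize_mdeg_lt; rewrite mdegD mdeg1 addn1.
  - move=> m i; rewrite mcoeff_deriv; elim: (m j).+1 => [|l IHl]; first by rewrite mulr0n D0.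
    by rewrite mulrS D_add IHl kf addr0.
  - pose v := \row_j (f^`M(j)).@[q].
    have v0 : v *m (\matrix_(i, j) D i (q j))^T = 0.
      apply/rowP => i; rewrite !mxE.
      transitivity (D i f.@[q]); last by rewrite fq D0.
      by rewrite (chain i kf); apply: eq_bigr => l _; rewrite !mxE.
    have : v = 0.
      apply/eqP; have := congr1 (mulmxr (\adj (\matrix_(i, j) D i (q j))^T)) v0.
      rewrite /= -mulmxA mul_mx_adj mul0mx mul_mx_scalar det_tr => /eqP.
      by rewrite scalemx_eq0 (negPf jac).
    by move=> /rowP/(_ j); rewrite !mxE.
have fC : f = (f@_0)%:MP.
  apply/mpolyP => m; rewrite mcoeffC.
  have [->|m0] := eqVneq m 0%MM; first by rewrite mulr1.
  rewrite mulr0; have /existsP[j mj] : [exists j, m j != 0%N].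
    apply: contraNT m0; rewrite negb_exists => /forallP H; apply/eqP/mnmP => j.
    by rewrite mnm0E; apply/eqP; have := H j; rewrite negbK.
  have := congr1 (mcoeff (m - U_(j))) (df j).
  rewrite mcoeff_deriv mcoeff0 submK; last first.
    by apply/mnm_lepP => l; rewrite mnm1E; case: eqP => // <-; rewrite lt0n.
  by move/eqP; rewrite -mulr_natr mulf_eq0 (negPf (A_char0 _)) orbF => /eqP.
by move: fq; rewrite fC mevalC => ->.
Qed.

End Independence.

(* More monomials in [g] and [x] than monomials in r variables of their degree. *)
Lemma algebraic_dependence (F : fieldType) r (g : 'I_r -> {mpoly F[r]})
    (x : {mpoly F[r]}) :
  exists2 G : {poly {mpoly F[r]}}, G != 0 &
    (map_poly (mmap (@mpolyC r F) g) G).[x] = 0.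
Proof.
pose K := (\max_i msize (g i) + msize x)%N.
(* There are n^(r+1) products of powers below n of the [g i] and [x]. Their exponents are below B <=
   (K(r+1)+1) n, so they lie in a space of dimension B^r <= (n-1) n^r < n^(r+1). *)
pose n := ((K * r.+1).+1 ^ r).+1; pose B := (K * (r.+1 * n)).+1.
pose T : finType := ({ffun 'I_r -> 'I_n} * 'I_n)%type.
pose T2 : finType := {ffun 'I_r -> 'I_B}.
pose mn (a : T) := [multinom a.1 i : nat | i < r].
pose el (a : T) := mmap1 g (mn a) * x ^+ a.2.
pose M := \matrix_(a < #|T|, b < #|T2|)
  (el (enum_val a))@_[multinom (enum_val b : T2) i : nat | i < r].
have cardT : (#|T2| < #|T|)%N.
  rewrite card_prod !card_ffun !card_ord -expnSr.
  have BK : (B <= (K * r.+1).+1 * n)%N.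
    by rewrite /B mulnA [leqRHS]mulSn -add1n leq_add2r.
  apply: leq_ltn_trans (_ : ((K * r.+1).+1 * n) ^ r < _)%N.
    by case: (r) BK => // s BK; rewrite leq_exp2r.
  by rewrite expnMn expnS ltn_pmul2r // expn_gt0.
have /rowV0Pn[l /sub_kermxP lM l0] : kermx M != 0.
  rewrite kermx_eq0 -row_leq_rank -ltnNge.
  exact: leq_ltn_trans (rank_leq_col _) cardT.
have el_deg a m : m \in msupp (el a) -> (mdeg m < B)%N.
  rewrite /el /mmap1; under eq_bigr => i _ do rewrite mnmE.
  have degM (p q : {mpoly F[r]}) d e :
      (msize p <= d.+1 -> msize q <= e.+1 -> msize (p * q) <= (d + e).+1)%N.
    have [->|p0] := eqVneq p 0; first by rewrite mul0r msize0.
    have [->|q0] := eqVneq q 0; first by rewrite mulr0 msize0.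
    move=> pd qe; rewrite msizeM //.
    by have := leq_add pd qe; rewrite addSn addnS; case: (_ + _)%N.
  have degX (p : {mpoly F[r]}) e : (msize p <= K -> msize (p ^+ e) <= (K * e).+1)%N.
    move=> pK; elim: e => [|e IHe]; first by rewrite expr0 msize1 muln0.
    by rewrite exprS mulnS; apply: degM IHe; apply: leqW.
  have degP (s : seq 'I_r) :
      (msize (\prod_(i <- s) g i ^+ a.1 i) <= (K * \sum_(i <- s) a.1 i).+1)%N.
    elim: s => [|i s IHs]; first by rewrite !big_nil msize1 muln0.
    rewrite !big_cons mulnDr; apply: degM IHs; apply: degX.
    apply: leq_trans (leq_addr _ _); exact: (leq_bigmax i).
  move=> /msize_mdeg_lt mel; rewrite /B ltnS.
  have {mel} : (mdeg m < (K * \sum_i a.1 i + K * a.2).+1)%N.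
    apply: leq_trans mel _; apply: degM; first exact: degP.
    by apply: degX; rewrite leq_addl.
  rewrite ltnS -mulnDr => /leq_trans; apply; rewrite leq_mul2l mulSn addnC.
  apply/orP; right; apply: leq_add; first exact: ltnW.
  apply: leq_trans (_ : (\sum_(i < r) n <= _)%N); last by rewrite sum_nat_const card_ord.
  by apply: leq_sum => i _; apply: ltnW.
exists (\sum_(a < #|T|) (l 0 a *: 'X_[mn (enum_val a)])%:P * 'X^((enum_val a).2)).
  apply: contraNneq l0 => G0; apply/eqP/rowP => a; rewrite mxE.
  have := congr1 (fun G : {poly {mpoly F[r]}} => (G`_((enum_val a).2))@_(mn (enum_val a))) G0.
  rewrite /= coef0 mcoeff0 => <-; rewrite coef_sum raddf_sum /= (bigD1 a) //= big1.
    by rewrite addr0 coefCM coefXn eqxx mulr1 mcoeffZ mcoeffX eqxx mulr1.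
  move=> b ba; rewrite coefCM coefXn; case: eqP => [e2|]; last by rewrite mulr0 mcoeff0.
  rewrite mulr1 mcoeffZ mcoeffX; case: eqP => [e1|]; last by rewrite mulr0.
  case/eqP: ba; apply: enum_val_inj; apply/esym/eqP/andP; split; last by apply/eqP/val_inj.
  apply/eqP/ffunP => i; apply: val_inj; move/mnmP/(_ i): e1.
  by rewrite /mn !mnmE.
rewrite rmorph_sum horner_sum.
under eq_bigr => a _ do
  rewrite rmorphM /= map_polyC map_polyXn hornerM hornerC hornerXn /= mmapZ mmapX -mulrA mul_mpolyC.
apply/mpolyP => m; rewrite mcoeff0 raddf_sum /=.
have [mB|mB] := boolP [forall i, (m i < B)%N]; last first.
  apply: big1 => a _; rewrite mcoeffZ -/(el _).
  rewrite (_ : _@_m = 0) ?mulr0 //; apply/eqP; rewrite mcoeff_eq0.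
  apply: contra mB => mB; apply/forallP => i; apply: leq_ltn_trans (el_deg _ _ mB).
  by rewrite mdegE (bigD1 i) //= leq_addr.
pose b : T2 := [ffun i => inord (m i)].
have mE : m = [multinom b i : nat | i < r].
  by apply/mnmP => i; rewrite mnmE ffunE inordK // (forallP mB).
move/rowP/(_ (enum_rank b)): lM; rewrite !mxE => lM; rewrite -[RHS]lM.
by apply: eq_bigr => a _; rewrite mcoeffZ mxE enum_rankK -mE.
Qed.

(** * Primitive elements over a domain *)

Local Notation tofrac := (@FracField.tofrac _).

Section FractionMorphism.
Local Open Scope quotient_scope.
Variable P : idomainType.

Lemma fractionE (x : {fraction P}) :
  exists ab : P * P, ab.2 != 0 /\ x = tofrac ab.1 / tofrac ab.2.
Proof.
exists (frac (repr x)); split; first exact: denom_ratioP.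
rewrite -[LHS]reprK; case: (repr x) => -[a b] /= b0.
rewrite /GRing.inv /GRing.mul /= !piE /FracField.invf /FracField.mulf.
rewrite !numden_Ratio ?oner_neq0 //= mul1r mulr1.
by congr (\pi _); apply/val_inj; rewrite /Ratio /insubd insubT.
Qed.

Lemma fraction_lift (L : fieldType) (g : {rmorphism P -> L}) : injective g ->
  exists iota : {rmorphism {fraction P} -> L}, forall a, iota (tofrac a) = g a.
Proof.
move=> gI; have g0 a : (g a == 0) = (a == 0) by rewrite -(rmorph0 g) (inj_eq gI).
pose ab x := sval (cid (fractionE x)).
have ab0 x : (ab x).2 != 0 by rewrite /ab; case: cid => ? [].
have abE x : x = tofrac (ab x).1 / tofrac (ab x).2 by rewrite /ab; case: cid => ? [].
pose i x := g (ab x).1 / g (ab x).2.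
have iE a b : b != 0 -> i (tofrac a / tofrac b) = g a / g b.
  move=> b0; rewrite /i; set x : {fraction P} := tofrac a / tofrac b.
  have /eqP := abE x; rewrite {1}/x eqr_div ?tofrac_eq0 //.
  rewrite -!tofracM tofrac_eq => /eqP e.
  by apply/eqP; rewrite eqr_div ?g0 // -!rmorphM e mulrC.
have iF a : i (tofrac a) = g a.
  by rewrite -[tofrac a]divr1 -[1]tofrac1 iE ?oner_neq0 // rmorph1 divr1.
have iB : zmod_morphism i.
  move=> x y; have [x0 y0] := (ab0 x, ab0 y).
  rewrite [in LHS](abE x) [in LHS](abE y) -mulNr -tofracN addf_div ?tofrac_eq0 //.
  rewrite -!tofracM -tofracD iE ?mulf_neq0 // !rmorphM rmorphD !rmorphM rmorphN.
  by rewrite -addf_div ?g0 // mulNr.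
have iM : monoid_morphism i.
  split; first by rewrite -tofrac1 iF rmorph1.
  move=> x y; have [x0 y0] := (ab0 x, ab0 y).
  rewrite [in LHS](abE x) [in LHS](abE y) mulf_div -!tofracM iE ?mulf_neq0 //.
  by rewrite !rmorphM -mulf_div.
pose iota : {rmorphism {fraction P} -> L} := HB.pack i
  (GRing.isZmodMorphism.Build _ _ i iB) (GRing.isMonoidMorphism.Build _ _ i iM).
by exists iota.
Qed.

Lemma clear_denominators (f : {poly {fraction P}}) :
  exists2 D : P, D != 0 & exists g, tofrac D *: f = map_poly tofrac g.
Proof.
elim/poly_ind: f => [|f c [D D0 [g fE]]].
  by exists 1; [exact: oner_neq0|exists 0; rewrite scaler0 rmorph0].
have [[a b] /= [b0 ->]] := fractionE c.
exists (D * b); first by rewrite mulf_neq0.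
exists (b *: g * 'X + (D * a)%:P).
rewrite rmorphD (rmorphM (map_poly tofrac)) /= map_polyX map_polyC /= map_polyZ -fE.
rewrite scalerDr scalerAl !scalerA tofracM [tofrac b * _]mulrC; congr (_ + _).
rewrite -mul_polyC -polyCM tofracM; congr (_%:P).
by rewrite -mulrA (mulrCA (tofrac b)) divff ?tofrac_eq0 // mulr1.
Qed.

End FractionMorphism.

(** The coefficients are integers so that the primitive element is a combination that every ring
    morphism preserves; it can then be read at a critical point. *)
Lemma primitive_combination (F L : fieldType) (iota : {rmorphism F -> L}) N
    (p : 'I_N -> L) :
  [pchar F] =i pred0 -> (forall c, algebraicOver iota (p c)) ->
  exists z : 'I_N -> int, algebraicOver iota (\sum_c p c *~ z c) /\
   forall c, exists q, (map_poly iota q).[\sum_c p c *~ z c] = p c.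
Proof.
move=> char0; elim: N p => [|N IH] p palg.
  exists (fun=> 0); split; last by case.
  by rewrite big_ord0 -(rmorph0 iota); apply: algebraic_id.
have [z [alg zq]] := IH (p \o lift ord0) (fun c => palg _).
have [g g0 gx] := palg ord0; have [h h0 hy] := alg.
have [n [[qx qxE] [qy qyE]]] := separable.pchar0_PET g0 gx h0 hy char0.
set t := \sum_c _ in alg zq hy qyE qxE *.
(* The primitive element theorem for two elements produces t n - p_0, whence the coefficient -1 for
   the new element and the factor n on the old ones. *)
have tE : \sum_c p c *~ (if unlift ord0 c is Some d then z d * n%:Z else -1) = t *+ n - p ord0.
  rewrite big_ord_recl unlift_none addrC mulrN1z; congr (_ + _).
  by rewrite /t -sumrMnl; apply: eq_bigr => c _; rewrite liftK /= mulrzA -pmulrn.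
exists (fun c => if unlift ord0 c is Some d then z d * n%:Z else -1); rewrite tE; split.
  apply: algebraic_sub => //; rewrite -mulr_natl; apply: algebraic_mul => //.
  by rewrite -(rmorph_nat iota); apply: algebraic_id.
move=> c; case: (unliftP ord0 c) => [d ->|->]; last by exists qx.
have [q qE] := zq d; exists (q \Po qy).
by rewrite map_comp_poly horner_comp qyE qE.
Qed.

(** The field version is applied to the fraction fields of [P] and [A]; clearing denominators brings
    the conclusion back to the domains. *)
Lemma primitive_element (P A : idomainType) (phi : {rmorphism P -> A}) N
    (p : 'I_N -> A) : injective phi -> [pchar P] =i pred0 ->
  (forall c, exists2 G : {poly P}, G != 0 & (map_poly phi G).[p c] = 0) ->
  exists z : 'I_N -> int,
    (exists2 G : {poly P}, G != 0 & (map_poly phi G).[\sum_c p c *~ z c] = 0) /\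
    forall c, exists2 D : P, D != 0 &
      exists G : {poly P}, phi D * p c = (map_poly phi G).[\sum_c p c *~ z c].
Proof.
move=> phiI char0 palg.
have fI : injective (tofrac : A -> _) by move=> x y /eqP; rewrite tofrac_eq => /eqP.
pose g : {rmorphism P -> {fraction A}} := tofrac \o phi.
have gI : injective g by move=> x y /fI/phiI.
have [iota iotaE] := fraction_lift gI.
have mapE (G : {poly P}) x :
    (map_poly iota (map_poly tofrac G)).[tofrac x] = tofrac (map_poly phi G).[x].
  rewrite -horner_map -!map_poly_comp; congr (_.[_]).
  by apply: eq_map_poly => a; rewrite /= iotaE.
have alg0 x : algebraicOver iota (tofrac x) ->
    exists2 G : {poly P}, G != 0 & (map_poly phi G).[x] = 0.
  move=> [f f0 /rootP fx]; have [D D0 [G fE]] := clear_denominators f.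
  exists G.
    apply: contraNneq f0 => G0; move/eqP: fE; rewrite G0 rmorph0 scaler_eq0 tofrac_eq0.
    by rewrite (negPf D0).
  by apply: fI; rewrite -mapE -fE map_polyZ hornerZ fx mulr0 rmorph0.
have charF : [pchar {fraction P}] =i pred0.
  by move=> l; rewrite -char0 !inE -(rmorph_nat tofrac) tofrac_eq0.
have [c|z [zalg zq]] := primitive_combination (p := tofrac \o p) charF (iota := iota).
  have [G G0 Gp] := palg c; exists (map_poly tofrac G); last by apply/rootP; rewrite mapE Gp rmorph0.
  by rewrite map_poly_eq0_id0 // tofrac_eq0 lead_coef_eq0.
exists z; set t := \sum_c _.
have tE : \sum_c (tofrac \o p) c *~ z c = tofrac t.
  by rewrite rmorph_sum; apply: eq_bigr => c _; rewrite rmorphMz.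
rewrite tE in zalg zq; split; first exact: alg0.
move=> c; have [q qE] := zq c; have [D D0 [G GE]] := clear_denominators q.
exists D => //; exists G; apply: fI.
by rewrite -mapE -GE map_polyZ hornerZ qE iotaE tofracM.
Qed.

Lemma primitive_element_common (P A : idomainType) (phi : {rmorphism P -> A}) N
    (p : 'I_N -> A) : injective phi -> [pchar P] =i pred0 ->
  (forall c, exists2 G : {poly P}, G != 0 & (map_poly phi G).[p c] = 0) ->
  exists z : 'I_N -> int,
    (exists2 G : {poly P}, G != 0 & (map_poly phi G).[\sum_c p c *~ z c] = 0) /\
    exists2 D : P, D != 0 & exists G : 'I_N -> {poly P},
      forall c, phi D * p c = (map_poly phi (G c)).[\sum_c p c *~ z c].
Proof.
move=> phiI char0 palg; have [z [zalg zq]] := primitive_element phiI char0 palg.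
exists z; split=> //; have /choice[D DG] : forall c, exists D : P, D != 0 /\
    exists G : {poly P}, phi D * p c = (map_poly phi G).[\sum_c p c *~ z c].
  by move=> c; have [D D0 [G GE]] := zq c; exists D; split=> //; exists G.
have /choice[G GE] : forall c, exists G : {poly P},
    phi (D c) * p c = (map_poly phi G).[\sum_c p c *~ z c] by move=> c; case: (DG c).
exists (\prod_c D c); first by apply/prodf_neq0 => c _; case: (DG c).
exists (fun c => (\prod_(c' | c' != c) D c')%:P * G c) => c.
rewrite (rmorphM (map_poly phi)) /= hornerM map_polyC hornerC -GE (bigD1 c) //= rmorphM.
by rewrite mulrA; congr (_ * _); rewrite mulrC.
Qed.

(** * Minimal polynomials over a domain *)

Section MinimalPolynomial.
Variables (P A : idomainType) (phi : {rmorphism P -> A}) (t : A) (M : {poly P}).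
Hypothesis phi_inj : injective phi.
Hypothesis M_neq0 : M != 0.
Hypothesis Mt : (map_poly phi M).[t] = 0.
Hypothesis M_min : forall G : {poly P}, G != 0 -> (map_poly phi G).[t] = 0 ->
  (size M <= size G)%N.

Let phi0 a : (phi a == 0) = (a == 0).
Proof. by rewrite -(rmorph0 phi) (inj_eq phi_inj). Qed.

(** The pseudo-remainder of [G] by [M] is shorter than [M] and vanishes at [t], hence is zero. *)
Lemma minimal_poly_dvd (G : {poly P}) : (map_poly phi G).[t] = 0 ->
  exists k, exists q : {poly P}, lead_coef M ^+ k *: G = q * M.
Proof.
move=> Gt; have E := Pdiv.Idomain.divp_eq G M.
exists (scalp G M), (G %/ M)%R; rewrite E; apply/eqP; rewrite -subr_eq0 addrC addKr.
apply: contraTT (Pdiv.Idomain.ltn_modpN0 G M_neq0) => r0; rewrite -leqNgt.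
apply: M_min => //; have := congr1 (fun G : {poly P} => (map_poly phi G).[t]) E.
by rewrite /= map_polyZ hornerZ Gt mulr0 rmorphD rmorphM hornerD hornerM Mt mulr0 add0r.
Qed.

Lemma minimal_poly_size : (1 < size M)%N.
Proof.
rewrite ltnNge; apply/negP => /size1_polyC ME; move/eqP: Mt.
rewrite ME map_polyC hornerC /= phi0; move: M_neq0; rewrite {1}ME polyC_eq0 => /negPf-> //.
Qed.

(** Up to scalars, the gcd of [M] and [G] divides [G], so it does not vanish at [t]; its cofactor in
    [M] then does, and minimality makes the gcd constant. The constant [rho] plays the part of a
    resultant: where it does not vanish, the specialized polynomials remain coprime. *)
Lemma minimal_poly_bezout (G : {poly P}) : (map_poly phi G).[t] != 0 ->
  exists U V, exists2 rho : P, rho != 0 & U * M + V * G = rho%:P.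
Proof.
move=> Gt; have : coprimep M G.
  rewrite /coprimep; set g := gcdp M G.
  have g0 : g != 0 by rewrite gcdp_eq0 negb_and M_neq0.
  have /Pdiv.Idomain.dvdpP[[a k] /= a0 kE] : (g %| M)%R by exact: dvdp_gcdl.
  have /Pdiv.Idomain.dvdpP[[b l] /= b0 lE] : (g %| G)%R by exact: dvdp_gcdr.
  have gt0 : (map_poly phi g).[t] != 0.
    apply: contraNneq Gt => gt0; have := congr1 (fun G : {poly P} => (map_poly phi G).[t]) lE.
    rewrite /= map_polyZ hornerZ rmorphM hornerM gt0 mulr0 => /eqP.
    by rewrite mulf_eq0 phi0 (negPf b0).
  have kt : (map_poly phi k).[t] = 0.
    have := congr1 (fun G : {poly P} => (map_poly phi G).[t]) kE.
    rewrite /= map_polyZ hornerZ rmorphM hornerM Mt mulr0 => /esym/eqP.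
    by rewrite mulf_eq0 (negPf gt0) orbF => /eqP.
  have k0 : k != 0.
    apply: contraNneq M_neq0 => k0; move/eqP: kE.
    by rewrite k0 mul0r scale_poly_eq0 (negPf a0).
  have := M_min k0 kt; have := congr1 (size : {poly P} -> nat) kE.
  rewrite /= size_scale // size_mul // => ->.
  move: g0; rewrite -size_poly_gt0; case: (size g) => // n _; rewrite addnS /=.
  by rewrite -{2}[size k]addn0 leq_add2l leqn0 eqSS.
move=> /Pdiv.Idomain.Bezout_coprimepP[[U V] /Pdiv.Idomain.eqpP[[a b] /= /andP[a0 b0] E]].
exists (a *: U), (a *: V), b => //.
by rewrite -!scalerAl -scalerDr E alg_polyC.
Qed.

Lemma minimal_poly_deriv : [pchar P] =i pred0 -> (map_poly phi M^`()).[t] != 0.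
Proof.
move=> char0; have M1 := minimal_poly_size.
have M'0 : M^`() != 0.
  rewrite -size_poly_gt0; apply: leq_trans (_ : (size M).-1.-1 < _)%N => //.
  rewrite ltnNge; apply/negP => H; have := nth_default 0 H.
  rewrite coef_deriv prednK; last by case: (size M) M1 => [|[]].
  move/eqP; rewrite -mulr_natr mulf_eq0 -lead_coefE lead_coef_eq0 (negPf M_neq0) /=.
  by rewrite pcharf0P in char0; rewrite char0; case: (size M) M1 => [|[]].
apply/negP => /eqP /(M_min M'0); rewrite leqNgt lt_size_deriv //.
Qed.

(** The pseudo-division identity lc(M)^k G = q M is preserved by [psi]. This carries relations
    satisfied by [t] to any root of the specialized polynomial. *)
Lemma minimal_poly_specialize (F : idomainType) (psi : {rmorphism P -> F}) x G :
  psi (lead_coef M) != 0 -> (map_poly psi M).[x] = 0 ->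
  (map_poly phi G).[t] = 0 -> (map_poly psi G).[x] = 0.
Proof.
move=> lc0 Mx /minimal_poly_dvd[k [q E]].
have := congr1 (fun G : {poly P} => (map_poly psi G).[x]) E.
rewrite /= map_polyZ hornerZ rmorphM hornerM Mx mulr0 rmorphXn => /eqP.
by rewrite mulf_eq0 expf_eq0 (negPf lc0) andbF => /eqP.
Qed.

(** When [M] has degree 1, pseudo-division by [M] leaves a constant remainder, which is the
    numerator sought. *)
Lemma minimal_poly_linear (d : P) (G : {poly P}) x : ((size M).-1 <= 1)%N -> d != 0 ->
  phi d * x = (map_poly phi G).[t] ->
  exists f g, f != 0 /\ phi f * x = phi g.
Proof.
move=> M1 d0 dG; have E := Pdiv.Idomain.divp_eq G M.
have /size1_polyC rE : (size (G %% M)%R <= 1)%N.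
  have := Pdiv.Idomain.ltn_modpN0 G M_neq0; have := minimal_poly_size.
  by move: M1; case: (size M) => [|[|[|?]]].
exists (lead_coef M ^+ scalp G M * d), (G %% M)%R`_0; split.
  by rewrite mulf_neq0 // expf_neq0 // lead_coef_eq0.
rewrite rmorphM -mulrA dG; have := congr1 (fun G : {poly P} => (map_poly phi G).[t]) E.
rewrite /= map_polyZ hornerZ rmorphD (rmorphM (map_poly phi)) hornerD hornerM Mt.
rewrite mulr0 add0r => ->; move: (G %% M)%R rE => rem rE.
by rewrite [in LHS]rE /= map_polyC hornerC.
Qed.

End MinimalPolynomial.

Lemma minimal_poly_exists (P A : idomainType) (phi : {rmorphism P -> A}) (t : A) :
  (exists2 G : {poly P}, G != 0 & (map_poly phi G).[t] = 0) ->
  exists M : {poly P}, [/\ M != 0, (map_poly phi M).[t] = 0 &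
    forall G : {poly P}, G != 0 -> (map_poly phi G).[t] = 0 -> (size M <= size G)%N].
Proof.
move=> [G G0 Gt].
pose Q k := `[< exists G : {poly P}, [/\ G != 0, (map_poly phi G).[t] = 0 & size G = k] >].
have exQ : exists k, Q k by exists (size G); apply/asboolP; exists G.
case: (ex_minnP exQ) => k /asboolP[M [M0 Mt <-]] Mmin.
by exists M; split=> // H H0 Ht; apply: Mmin; apply/asboolP; exists H.
Qed.

(** * The toric cone and its vanishing ideal *)

Section Cone.
Variable R : realType.
Local Notation C := (complex R).
Local Notation "x %:CC" := (real_complex R x) (at level 2, format "x %:CC").

Definition mono m N (a : 'M[nat]_(m, N)) (c : 'I_N) : {mpoly C[m]} :=
  'X_[[multinom a i c | i < m]].

Definition natmx m N (a : 'M[nat]_(m, N)) : 'M[R]_(m, N) := map_mx (fun k => k%:R) a.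

Definition cone m N (A : 'M[R]_(m, N)) (p : 'rV[R]_N) :=
  (forall c, 0 < p 0 c) /\ (map_mx (@exp.ln R) p <= A)%MS.

Definition vanish m N (A : 'M[R]_(m, N)) (f : {mpoly C[N]}) :=
  forall p, cone A p -> f.@[map_mx (real_complex R) p 0] = 0.

Definition linform m N k (A : 'M[R]_(m, N)) (x : 'I_N -> {mpoly C[k]}) i : {mpoly C[k]} :=
  \sum_c (A i c)%:CC *: x c.

Definition pull m N (A : 'M[R]_(m, N)) (f : {mpoly C[m]}) : {mpoly C[N]} :=
  mmap (@mpolyC N C) (linform A (fun c => 'X_c)) f.

(** The equation X_c = g(b) / f(b) for the moment map b = A X, with its denominator cleared. Stated
    through [vanish], it involves no function field. *)
Definition rational_mle m N (A : 'M[R]_(m, N)) := forall c : 'I_N,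
  exists f g : {mpoly C[m]}, ~ vanish A (pull A f) /\
    vanish A (pull A f * 'X_c - pull A g).

Lemma mmap_mpolyC_meval n k (h : 'I_n -> {mpoly C[k]}) (v : 'I_k -> C) f :
  (mmap (@mpolyC k C) h f).@[v] = f.@[fun i => (h i).@[v]].
Proof.
rewrite (rmorph_mmap _ (meval v)) /=.
by apply: eq_mmap => // c /=; rewrite mevalC.
Qed.

Lemma pullE m N (A : 'M[R]_(m, N)) f :
  pull A f = mmap (@mpolyC N C) (linform A (fun c => 'X_c)) f.
Proof. by []. Qed.

Lemma meval_pull m N (A : 'M[R]_(m, N)) f (v : 'I_N -> C) :
  (pull A f).@[v] = f.@[fun i => \sum_c (A i c)%:CC * v c].
Proof.
rewrite mmap_mpolyC_meval; apply: meval_eq => i; rewrite /linform rmorph_sum.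
by apply: eq_bigr => c _; rewrite /= mevalZ mevalXU.
Qed.

Lemma mmap_pull N k (M : 'M[R]_(k, N)) m (h : 'I_N -> {mpoly C[m]}) f :
  mmap (@mpolyC m C) h (pull M f) = mmap (@mpolyC m C) (linform M h) f.
Proof.
rewrite /pull (rmorph_mmap _ (mmap (@mpolyC m C) h)).
apply: eq_mmap => [x|i] /=; first by rewrite mmapC.
rewrite /linform rmorph_sum; apply: eq_bigr => c _.
by rewrite /= mmapZ mmapX mmap1U mul_mpolyC.
Qed.

(** Positive parameters map onto the cone by exponentials, and a nonzero polynomial in the
    parameters is nonzero at some positive integer point. Thus the vanishing ideal is the kernel of
    a morphism into a domain. *)
Lemma vanish_mono m N (a : 'M[nat]_(m, N)) f :
  vanish (natmx a) f <-> mmap (@mpolyC m C) (mono a) f = 0.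
Proof.
split=> [fA|f0 p [p0 /submxP[y yE]]]; last first.
  pose z i := sequences.expR (y 0 i).
  have := congr1 (meval (fun i => (z i)%:CC)) f0.
  rewrite meval0 mmap_mpolyC_meval => <-; apply: meval_eq => c.
  rewrite mevalX mxE -(exp.lnK (p0 c)).
  move/rowP/(_ c): yE; rewrite !mxE => ->.
  rewrite (big_morph _ (@exp.expRD R) (@exp.expR0 R)) rmorph_prod; apply: eq_bigr => i _.
  by rewrite mxE mnmE mulrC exp.expRM_natl rmorphXn.
apply: contrapT => /eqP /mpoly_neq0_pt[v vpos]; apply/negP; rewrite negbK.
rewrite mmap_mpolyC_meval.
have vp i n : 0 < ((v i)%:R : R) ^+ n by rewrite exprn_gt0 // ltr0n vpos.
pose p := \row_c \prod_i ((v i)%:R : R) ^+ a i c.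
rewrite (@meval_eq _ _ _ (map_mx (real_complex R) p 0)).
  apply/eqP/fA; split=> [c|]; first by rewrite mxE; apply: prodr_gt0 => i _; apply: vp.
  apply/submxP; exists (\row_i exp.ln ((v i)%:R : R)); apply/rowP => c; rewrite !mxE.
  have ln_prod (s : seq 'I_m) : exp.ln (\prod_(i <- s) ((v i)%:R : R) ^+ a i c) =
     \sum_(i <- s) exp.ln ((v i)%:R : R) * (a i c)%:R.
    elim: s => [|i s IH]; first by rewrite !big_nil exp.ln1.
    rewrite !big_cons exp.lnM ?posrE.
    - by rewrite IH exp.lnXn ?mulr_natr // -[_%:R]expr1 vp.
    - exact: vp.
    - by apply: prodr_gt0 => j _; apply: vp.
  by rewrite ln_prod; apply: eq_bigr => i _; rewrite !mxE.
move=> c; rewrite mevalX !mxE rmorph_prod; apply: eq_bigr => i _.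
by rewrite mnmE rmorphXn rmorph_nat.
Qed.

Lemma vanish_pull m N (a : 'M[nat]_(m, N)) k (M : 'M[R]_(k, N)) f :
  vanish (natmx a) (pull M f) <-> mmap (@mpolyC m C) (linform M (mono a)) f = 0.
Proof. by rewrite -(mmap_pull M (mono a) f); apply: vanish_mono. Qed.

Lemma vanish_pullX m N (a : 'M[nat]_(m, N)) k (M : 'M[R]_(k, N)) f g c :
  vanish (natmx a) (pull M f * 'X_c - pull M g) <->
  mmap (@mpolyC m C) (linform M (mono a)) f * mono a c =
  mmap (@mpolyC m C) (linform M (mono a)) g.
Proof.
rewrite -(mmap_pull M (mono a) f) -(mmap_pull M (mono a) g).
move: (pull M f) (pull M g) => F G; rewrite vanish_mono mmapB.
rewrite (rmorphM (mmap _ _)) /= mmapX mmap1U.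
by split=> [/eqP|->]; rewrite ?subrr // subr_eq0 => /eqP.
Qed.

Lemma vanish_eqmx m m' N (A : 'M[R]_(m, N)) (B : 'M[R]_(m', N)) f :
  (A :=: B)%MS -> vanish A f -> vanish B f.
Proof. by move=> AB fA p [p0 pB]; apply: fA; split=> //; rewrite AB. Qed.

(** The cone depends only on the row space, and if A = Z B then a polynomial in A X is a polynomial
    in B X. *)
Lemma rational_mle_eqmx m m' N (A : 'M[R]_(m, N)) (B : 'M[R]_(m', N)) :
  (A :=: B)%MS -> rational_mle A -> rational_mle B.
Proof.
move=> AB ratA c; have [f [g [fA fgA]]] := ratA c.
have [Z ZE] : exists Z, A = Z *m B by apply/submxP; rewrite AB.
have pullE h : pull B (pull Z h) = pull A h.
  rewrite /pull (rmorph_mmap _ (mmap (@mpolyC N C) (linform B (fun c => 'X_c)))).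
  apply: eq_mmap => [x|i] /=; first by rewrite mmapC.
  rewrite /linform rmorph_sum /=.
  under eq_bigr => j _ do rewrite mmapZ mmapX mmap1U mul_mpolyC scaler_sumr.
  rewrite exchange_big /=; apply: eq_bigr => d _.
  under eq_bigr => j _ do rewrite scalerA.
  by rewrite -scaler_suml ZE mxE rmorph_sum; congr (_ *: _); apply: eq_bigr => j _; rewrite rmorphM.
exists (pull Z f), (pull Z g); move: (pull Z f) (pull Z g) (pullE f) (pullE g) => f' g' -> ->; split.
  by move=> fB; apply: fA; apply: (vanish_eqmx (eqmx_sym AB) fB).
by apply: (vanish_eqmx AB fgA).
Qed.

(** The Euler derivation in direction [v]: it multiplies each monomial by the pairing of [v] with
    the exponent, hence is diagonal on monomials. *)
Definition eulerD m (v : 'I_m -> R) (h : {mpoly C[m]}) : {mpoly C[m]} :=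
  \sum_k (v k)%:CC *: ('X_k * h^`M(k)).

Lemma eulerD_add m (v : 'I_m -> R) : {morph eulerD v : x y / x + y}.
Proof.
move=> x y; rewrite /eulerD -big_split; apply: eq_bigr => k _.
by rewrite mderivD mulrDr scalerDr.
Qed.

Lemma eulerD_mul m (v : 'I_m -> R) x y :
  eulerD v (x * y) = eulerD v x * y + x * eulerD v y.
Proof.
rewrite /eulerD mulr_suml mulr_sumr -big_split; apply: eq_bigr => k _ /=.
rewrite mderivM mulrDr scalerDr -!scalerAl -!scalerAr; congr (_ *: _ + _ *: _).
  by rewrite mulrA.
by rewrite mulrCA.
Qed.

Lemma eulerD_C m (v : 'I_m -> R) x : eulerD v x%:MP = 0.
Proof. by rewrite /eulerD big1 // => k _; rewrite mderivC mulr0 scaler0. Qed.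

Lemma eulerD_0 m (v : 'I_m -> R) : eulerD v 0 = 0.
Proof. exact: (eulerD_C v 0). Qed.

Lemma eulerD_Z m (v : 'I_m -> R) z x : eulerD v (z *: x) = z *: eulerD v x.
Proof. by rewrite -mul_mpolyC eulerD_mul eulerD_C mul0r add0r mul_mpolyC. Qed.

Lemma eulerD_N m (v : 'I_m -> R) x : eulerD v (- x) = - eulerD v x.
Proof. by rewrite -scaleN1r eulerD_Z scaleN1r. Qed.

Lemma eulerD_sum m (v : 'I_m -> R) (I : Type) (s : seq I) F :
  eulerD v (\sum_(i <- s) F i) = \sum_(i <- s) eulerD v (F i).
Proof. by apply: (big_morph _ (eulerD_add v)); exact: (eulerD_C v 0). Qed.

Lemma eulerD_mmap m (v : 'I_m -> R) n (h : 'I_n -> {mpoly C[m]}) f :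
  (forall i, eulerD v (h i) = 0) -> eulerD v (mmap (@mpolyC m C) h f) = 0.
Proof.
move=> h0; have eM : forall x y, eulerD v x = 0 -> eulerD v y = 0 -> eulerD v (x * y) = 0.
  by move=> x y x0 y0; rewrite eulerD_mul x0 y0 mul0r mulr0 addr0.
have e1 : eulerD v 1 = 0 by rewrite -(eulerD_C v 1).
rewrite /mmap eulerD_sum; apply: big1 => mu _; apply: (eM _ _ (eulerD_C _ _)).
have eX : forall x k, eulerD v x = 0 -> eulerD v (x ^+ k) = 0.
  move=> x k x0; elim: k => [|k IH]; first (rewrite expr0; exact: e1).
  rewrite exprS; exact: (eM _ _ x0 IH).
exact: (big_ind (fun x => eulerD v x = 0) e1 eM (fun i _ => eX _ _ (h0 i))).
Qed.

Lemma eulerD_mono m N (a : 'M[nat]_(m, N)) (v : 'rV[R]_m) c :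
  eulerD (v 0) (mono a c) = ((v *m natmx a) 0 c)%:CC *: mono a c.
Proof.
rewrite /eulerD /mono mxE rmorph_sum scaler_suml; apply: eq_bigr => k _.
rewrite mderivX -scalerAr scalerA mxE rmorphM rmorph_nat.
rewrite -mpolyXD mnmE; case: (posnP (a k c)) => [->|ak]; first by rewrite !mulr0 !scale0r.
congr (_ *: 'X_[_]); rewrite addmC submK //.
by apply/mnm_lepP => l; rewrite !mnmE; case: eqP => // <-.
Qed.

Lemma char0_mpoly m k : k.+1%:R != 0 :> {mpoly C[m]}.
Proof.
by rewrite -(rmorph_nat (@mpolyC m C)) mpolyC_eq0 pnatr_eq0.
Qed.

(* The Jacobian of [E p], with respect to the derivations attached to the rows
   of [E], is [E diag(p) E^T]: at the point of ones it is a Gram matrix. *)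
Lemma linform_mono_indep m N r (a : 'M[nat]_(m, N)) (V : 'M[R]_(r, m))
    (f : {mpoly {mpoly C[m]}[r]}) :
  row_free (V *m natmx a) -> (forall mu i, eulerD (row i V 0) f@_mu = 0) ->
  f.@[linform (V *m natmx a) (mono a)] = 0 -> f = 0.
Proof.
set E := V *m _ => Efree fD; apply: (jacobian_indep (D := fun i => eulerD (row i V 0))).
- exact: char0_mpoly.
- by move=> i; apply: eulerD_add.
- by move=> i; apply: eulerD_mul.
- set J := \matrix_(i, j) _; have JE : map_mx (meval (fun=> 1)) J = map_mx (real_complex R) (E *m E^T).
    apply/matrixP => i j; rewrite !mxE eulerD_sum !rmorph_sum; apply: eq_bigr => c _.
    rewrite eulerD_Z eulerD_mono /= !mevalZ mevalX big1 ?mulr1; last by move=> k _; rewrite expr1n.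
    by rewrite -rmorphM -row_mul [row _ _ _ _]mxE [_^T _ _]mxE mulrC.
  apply: contraTneq (Efree) => J0.
  have : \det (E *m E^T) = 0.
    apply: (fmorph_inj (real_complex R)).
    by rewrite rmorph0 -det_map_mx -JE det_map_mx J0 rmorph0.
  have Einj (w : 'rV[R]_r) : w *m E = 0 -> w = 0.
    by move/eqP; rewrite mulmx_free_eq0 // => /eqP.
  move/eqP/det0P => [w w0 wE]; case/eqP: w0; apply: Einj.
  have := congr1 (fun M => (M *m w^T) 0 0) wE.
  rewrite /= mulmxA -mulmxA -trmx_mul mul0mx mxE [RHS]mxE => /eqP.
  rewrite psumr_eq0 => [/allP H|c _]; last by rewrite [X in _ * X]mxE -expr2 sqr_ge0.
  apply/rowP => c; have := H c (mem_index_enum c).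
  by rewrite [X in _ * X]mxE [RHS]mxE -expr2 sqrf_eq0 => /eqP.
- exact: fD.
Qed.

End Cone.

(* Unfolding [pull] makes unification diverge. *)
Opaque pull.

(** * Degeneration to a face *)

(** Read the coefficient of 'X^d. Monomials of degree above d contribute only to higher orders, and
    those of degree d only through the constant terms of their coefficients; [H0] collects the
    latter. *)
Lemma lowest_order (K : comNzRingType) r (q : 'I_r -> K) (H : {mpoly {poly K}[r]}) d :
  (forall mu, (mdeg mu < d)%N -> H@_mu = 0) ->
  H.@[fun j => (q j)%:P * 'X] = 0 ->
  exists2 H0 : {mpoly K[r]}, H0.@[q] = 0 &
    forall mu, H0@_mu = if mdeg mu == d then H@_mu`_0 else 0.
Proof.
move=> Hd Hq; pose H0 := \sum_(mu <- msupp H) (if mdeg mu == d then H@_mu`_0 else 0) *: 'X_[K, mu].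
exists H0 => [|mu].
  rewrite /H0 rmorph_sum /=; transitivity ((H.@[fun j => (q j)%:P * 'X])`_d); last by rewrite Hq coef0.
  rewrite mevalE coef_sum; apply: eq_bigr => mu _.
  have -> : \prod_i ((q i)%:P * 'X) ^+ mu i = (\prod_i q i ^+ mu i)%:P * 'X^(mdeg mu).
    rewrite rmorph_prod mdegE -prodrXr -big_split; apply: eq_bigr => i _ /=.
    by rewrite exprMn rmorphXn.
  rewrite mulrA coefMXn mevalZ mevalX coefMC.
  case: (ltngtP (mdeg mu) d) => [lt|gt|->]; last by rewrite subnn.
    by rewrite mul0r Hd // coef0 mul0r.
  by rewrite mul0r.
rewrite /H0 raddf_sum /=; under eq_bigr => nu _ do rewrite mcoeffZ mcoeffX.
case: (boolP (mu \in msupp H)) => mH.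
  rewrite (bigD1_seq mu) ?msupp_uniq //= eqxx mulr1 big1 ?addr0 // => nu /negPf ->.
  exact: mulr0.
rewrite big_seq big1 => [|nu nH].
  by move: mH; rewrite -mcoeff_eq0 => /eqP ->; rewrite coef0 if_same.
by case: (nu =P mu) nH => [->|_ _]; rewrite ?(negPf mH) ?mulr0.
Qed.

Section Face.
Variable R : realType.
Local Notation C := (complex R).
Local Notation "x %:CC" := (real_complex R x) (at level 2, format "x %:CC").

(** Constants are killed by every derivation, so the moment coordinates along independent rows are
    algebraically independent over C. *)
Lemma linform_mono_inj m N r (a : 'M[nat]_(m, N)) (V : 'M[R]_(r, m)) (f : {mpoly C[r]}) :
  row_free (V *m natmx R a) ->
  mmap (@mpolyC m C) (linform (V *m natmx R a) (mono R a)) f = 0 -> f = 0.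
Proof.
move=> Efree fE; have : map_mpoly (@mpolyC m C) f = 0.
  apply: (linform_mono_indep Efree) => [mu i|].
    by rewrite mcoeff_map_mpoly eulerD_C.
  by rewrite meval_map_mpoly.
move=> f0; apply/mpolyP => mu; have := congr1 (mcoeff mu) f0.
by rewrite mcoeff_map_mpoly !mcoeff0 => /eqP; rewrite mpolyC_eq0 => /eqP.
Qed.

Section FaceBasis.
Variables (m N N' : nat) (A : 'M[R]_(m, N)) (f : 'I_N' -> 'I_N).

(** Splits the row space of [A] into rows that restrict to a row basis on the face and independent
    rows that vanish there. The latter form a basis of what remains of [A] after subtracting the
    combinations of the former that agree with it on the face. *)
Lemma face_basis : exists r (V0 : 'M[R]_(r, m)) (V1 : 'M[R]_(\rank (colsub f A), m))
    (Z0 : 'M[R]_(m, r)) (Z1 : 'M[R]_(m, \rank (colsub f A))),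
  [/\ A = Z1 *m (V1 *m A) + Z0 *m (V0 *m A),
      colsub f (V0 *m A) = 0, row_free (V0 *m A)
    & colsub f (V1 *m A) = row_base (colsub f A)].
Proof.
set F := colsub f A.
have csM k (V : 'M[R]_(k, m)) : colsub f (V *m A) = V *m F.
  by rewrite /F; apply/matrixP => i j; rewrite !mxE; apply: eq_bigr => l _; rewrite !mxE.
pose V1 := row_base F *m pinvmx F; pose Z1 := F *m pinvmx (row_base F).
pose W := 1%:M - Z1 *m V1; pose A' := W *m A.
have V1F : V1 *m F = row_base F by rewrite mulmxKpV // eq_row_base.
have WF : W *m F = 0.
  by rewrite mulmxBl mul1mx -mulmxA V1F mulmxKpV ?subrr // eq_row_base.
exists (\rank A'), (row_base A' *m pinvmx A' *m W), V1, (A' *m pinvmx (row_base A')), Z1.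
have V0A : row_base A' *m pinvmx A' *m W *m A = row_base A'.
  by rewrite -mulmxA mulmxKpV // eq_row_base.
split; last by rewrite csM.
- rewrite V0A mulmxKpV ?eq_row_base // /A' mulmxBl mul1mx addrC mulmxA subrK //.
- by rewrite csM -[_ *m W *m F]mulmxA WF mulmx0.
- by rewrite V0A row_base_free.
Qed.

End FaceBasis.

Section FaceDegeneration.
Variables (m N N' : nat) (a : 'M[nat]_(m, N)) (g : 'I_m -> nat) (f : 'I_N' -> 'I_N).
Let w c := (\sum_i g i * a i c)%N.
Hypothesis w_le1 : forall c, (w c <= 1)%N.
Hypothesis f_inj : injective f.
Hypothesis f_face : forall c, (w c == 0%N) = (c \in codom f).

Let A := natmx R a.
Let P := mono R a.
Let epsform k (M : 'M[R]_(k, N)) i : {poly {mpoly C[m]}} :=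
  \sum_d ((M i d)%:CC%:MP)%:P * ((P d)%:P * 'X^(w d)).
(** The parameter [i] is scaled by the power [g i] of the new variable, so the monomial [d] acquires
    the factor 'X^(w d). Setting the variable to 1 undoes this, and setting it to 0 keeps the
    monomials of the face. *)
Let eps : {rmorphism {mpoly C[m]} -> {poly {mpoly C[m]}}} :=
  mmap (polyC \o @mpolyC m C) (fun i => ('X_i)%:P * 'X^(g i)).

Let epsE h : eps h = mmap (polyC \o @mpolyC m C) (fun i => ('X_i)%:P * 'X^(g i)) h.
Proof. by []. Qed.

Let eps_mono d : eps (P d) = (P d)%:P * 'X^(w d).
Proof.
rewrite epsE /P /mono mmapX /mmap1 mpolyXE_id rmorph_prod /w -prodrXr -big_split /=.
by apply: eq_bigr => i _; rewrite mnmE exprMn rmorphXn -exprM.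
Qed.

Let eps_linform k (M : 'M[R]_(k, N)) i : eps (linform M P i) = epsform M i.
Proof.
rewrite /linform rmorph_sum; apply: eq_bigr => d _.
by rewrite -mul_mpolyC rmorphM eps_mono epsE mmapC.
Qed.

Let eps1 h : (eps h).[1] = h.
Proof.
rewrite -[LHS]/(horner_eval 1 _) epsE (rmorph_mmap _ (horner_eval 1)) /=.
rewrite -[RHS]comp_mpoly_id; apply: eq_mmap => [x|i] /=; rewrite /horner_eval.
  by rewrite hornerC.
by rewrite hornerM hornerC hornerXn expr1n mulr1 tnth_mktuple.
Qed.

Let epsform_mul k l (Z : 'M[R]_(k, l)) (M : 'M[R]_(l, N)) i :
  epsform (Z *m M) i = \sum_j ((Z i j)%:CC%:MP)%:P * epsform M j.
Proof.
rewrite /epsform; under [RHS]eq_bigr => j _ do rewrite mulr_sumr.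
rewrite exchange_big; apply: eq_bigr => d _ /=.
under [RHS]eq_bigr => j _ do rewrite mulrA.
rewrite -mulr_suml mxE !rmorph_sum; congr (_ * _); apply: eq_bigr => j _.
by rewrite !rmorphM.
Qed.

Let epsform_add k (M M' : 'M[R]_(k, N)) i :
  epsform (M + M') i = epsform M i + epsform M' i.
Proof.
rewrite /epsform -big_split; apply: eq_bigr => d _ /=.
by rewrite mxE !rmorphD mulrDl.
Qed.

Let epsform_face k (M : 'M[R]_(k, N)) i :
  (epsform M i)`_0 = linform (colsub f M) (P \o f) i.
Proof.
rewrite /epsform coef_sum (bigID (fun d => d \in codom f)) /= addrC big1 ?add0r.
  rewrite -(big_uniq _ (introT (injectiveP f) f_inj)) /codom /image_mem big_map big_enum /=.
  apply: eq_bigr => d _; rewrite coefCM coefCM coefXn mxE.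
  by have /eqP -> : w (f d) == 0%N; rewrite ?f_face ?codom_f // mulr1 mul_mpolyC.
move=> d; rewrite -f_face => wd; rewrite coefCM coefCM coefXn.
by rewrite eq_sym (negPf wd) mulr0 mulr0.
Qed.

(** All columns off the face have weight exactly 1, so on rows vanishing on the face the form is
    homogeneous of order 1 and not only of that lowest order. *)
Let epsform_offface k (M : 'M[R]_(k, N)) i : colsub f M = 0 ->
  epsform M i = (linform M P i)%:P * 'X.
Proof.
move=> M0; rewrite /epsform /linform rmorph_sum mulr_suml; apply: eq_bigr => d _ /=.
have [|wd] := boolP (d \in codom f).
  move=> /codomP[d' ->]; move/matrixP/(_ i d'): M0; rewrite !mxE => ->.
  by rewrite !rmorph0 scale0r !mul0r.
have -> : w d = 1%N.
  by move: wd (w_le1 d); rewrite -f_face; case: (w d) => [|[]].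
by rewrite -mul_mpolyC polyCM mulrA.
Qed.

Let mono_face d : P (f d) = mono R (colsub f a) d.
Proof. by congr 'X_[_]; apply/mnmP => i; rewrite !mnmE mxE. Qed.

Lemma rational_mle_face : rational_mle A -> rational_mle (natmx R (colsub f a)).
Proof.
move=> ratA.
have FE : natmx R (colsub f a) = colsub f A by apply/matrixP => i j; rewrite !mxE.
rewrite FE; apply: (rational_mle_eqmx (eq_row_base (colsub f A))) => c'.
have [D [Q [D0 DQ]]] := ratA (f c').
have [r [V0 [V1 [Z0 [Z1 [AE E0f E0free E1f]]]]]] := face_basis A f.
set E0 := V0 *m A in AE E0f E0free; set E1 := V1 *m A in AE E1f.
pose r1 := \rank (colsub f A).
pose phi := mmap (@mpolyC m C) (linform A P).
have {D0} D0 : phi D != 0.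
  by apply: contra_notN D0 => /eqP D0; apply/vanish_pull.
have {DQ} DQ : phi D * P (f c') = phi Q by apply/vanish_pullX.
pose q := linform E0 P; pose v := linform (row_base (colsub f A)) (P \o f).
pose al : {rmorphism {mpoly C[r1]} -> {poly {mpoly C[m]}}} :=
  mmap (polyC \o @mpolyC m C) (epsform E1).
have al0 h : (al h)`_0 = mmap (@mpolyC m C) v h.
  rewrite -horner_coef0 -[LHS]/(horner_eval 0 _) /al (rmorph_mmap _ (horner_eval 0)).
  apply: eq_mmap => [x|i] /=; rewrite /horner_eval; first by rewrite hornerC.
  by rewrite horner_coef0 epsform_face E1f.
have alE h : al h = mmap (polyC \o @mpolyC m C) (epsform E1) h by [].
(* By A = Z1 E1 + Z0 E0, a polynomial in b becomes one in the forms of [E0], the outer variables,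
   with coefficients polynomial in the forms of [E1], the inner variables. *)
pose til : {rmorphism {mpoly C[m]} -> {mpoly {mpoly C[r1]}[r]}} :=
  mmap (@mpolyC r _ \o @mpolyC r1 C) (fun i =>
    \sum_j (Z1 i j)%:CC%:MP%:MP * ('X_j)%:MP + \sum_j (Z0 i j)%:CC%:MP%:MP * 'X_j).
have tilE h : mmap al (fun j => (q j)%:P * 'X) (til h) = eps (phi h).
  rewrite (rmorph_mmap _ (mmap al _)) (rmorph_mmap _ eps).
  apply: eq_mmap => [x|i] /=; first (rewrite !mmapC; exact: mmapC).
  rewrite -[RHS]/(eps _) eps_linform (congr1 (fun M => epsform M i) AE) epsform_add !epsform_mul rmorphD !rmorph_sum /=.
  congr (_ + _); apply: eq_bigr => j _; rewrite (rmorphM (mmap al _)) /=; congr (_ * _).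
  - rewrite mmapC; exact: mmapC.
  - rewrite mmapC; etransitivity; [exact: mmapX|exact: mmap1U].
  - rewrite mmapC; exact: mmapC.
  - by rewrite mmapX mmap1U (epsform_offface _ E0f).
have E2 : eps (phi Q) = (P (f c'))%:P * eps (phi D).
  rewrite -DQ rmorphM eps_mono mulrC.
  by have /eqP -> : w (f c') == 0%N; rewrite ?f_face ?codom_f // mulr1.
pose qX j : {poly {mpoly C[m]}} := (q j)%:P * 'X.
have tilQ : mmap al qX (til Q) = (P (f c'))%:P * mmap al qX (til D).
  exact: (etrans (tilE Q) (etrans E2 (congr1 _ (esym (tilE D))))).
have tilD0 : til D != 0.
  apply: contraNneq D0 => D0; have := tilE D; rewrite D0 (rmorph0 (mmap _ _)) => E.
  by rewrite -(eps1 (phi D)) -E horner0.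
clear E2 tilE alE; move: al al0 tilQ tilD0 => al al0.
move: (til Q) (til D) => {til} tQ tD tilQ tilD0.
pose H := map_mpoly al tQ - ((P (f c'))%:P)%:MP * map_mpoly al tD.
have Hmu mu : H@_mu = al tQ@_mu - (P (f c'))%:P * al tD@_mu.
  by rewrite /H mcoeffB mcoeffCM (mcoeff_map_mpoly al) (mcoeff_map_mpoly al).
have Hq : H.@[qX] = 0.
  by rewrite /H mevalB mevalM mevalC !meval_map_mpoly tilQ subrr.
(* The lowest degree is taken over the supports of both polynomials, so that no term of [H] lies
   below it. That the denominator really has the coefficient [mu] is proved in [Dmu]. *)
have [mu [muS mu_min]] : exists mu, mu \in msupp tD ++ msupp tQ /\
    forall nu, nu \in msupp tD ++ msupp tQ -> (mdeg mu <= mdeg nu)%N.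
  set s := _ ++ _; pose p n := has (fun nu => mdeg nu == n) s.
  have exp : exists n, p n.
    exists (mdeg (mlead tD)); apply/hasP; exists (mlead tD) => //.
    by rewrite mem_cat mlead_supp.
  case: (ex_minnP exp) => n /hasP[mu mus /eqP <-] nmin; exists mu; split=> // nu nus.
  by apply: nmin; apply/hasP; exists nu.
have [nu nud|H0 H0q H0E] := lowest_order (d := mdeg mu) _ Hq.
  have : nu \notin msupp tD ++ msupp tQ.
    by apply: contraTN nud => /mu_min; rewrite leqNgt.
  rewrite mem_cat negb_or -!mcoeff_eq0 => /andP[/eqP nuD /eqP nuQ].
  by rewrite Hmu nuD nuQ !rmorph0 mulr0 subrr.
(* The rows of [E0] vanish on the face, so the Euler derivations along [V0] kill the face monomials,
   hence also the coefficients of [H0], which are polynomials in these. *)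
have H00 : H0 = 0.
  apply: (linform_mono_indep E0free _ H0q) => nu i.
  rewrite H0E; case: ifP => _; last exact: eulerD_0.
  have kP d : eulerD (row i V0 0) (P (f d)) = 0.
    rewrite eulerD_mono -row_mul -/E0 mxE.
    by move/matrixP/(_ i d): E0f; rewrite !mxE => ->; rewrite rmorph0 scale0r.
  have kv j : eulerD (row i V0 0) (v j) = 0.
    by rewrite eulerD_sum; apply: big1 => d _; rewrite eulerD_Z kP scaler0.
  rewrite Hmu coefB coefCM !al0 eulerD_add eulerD_N eulerD_mul kP mul0r add0r.
  have kG h : eulerD (row i V0 0) (mmap (@mpolyC m C) v h) = 0 by exact: eulerD_mmap.
  by rewrite [X in X - _]kG [X in - (_ * X)]kG mulr0 subr0.
have muE : mmap (@mpolyC m C) v tD@_mu * P (f c') = mmap (@mpolyC m C) v tQ@_mu.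
  have := congr1 (mcoeff mu) H00; rewrite H0E eqxx mcoeff0 Hmu coefB coefCM !al0.
  by move/eqP; rewrite subr_eq0 mulrC => /eqP ->.
have rbE : (natmx R (colsub f a) :=: row_base (colsub f A))%MS.
  by rewrite FE; apply: eqmx_sym (eq_row_base _).
have V1E : V1 *m natmx R (colsub f a) = row_base (colsub f A).
  rewrite FE -E1f /E1; apply/matrixP => i j; rewrite !mxE.
  by apply: eq_bigr => l _; rewrite !mxE.
have vE h : mmap (@mpolyC m C) v h =
    mmap (@mpolyC m C) (linform (row_base (colsub f A)) (mono R (colsub f a))) h.
  by apply: eq_mmap => // i; apply: eq_bigr => d _; rewrite /= mono_face.
have v_inj h : mmap (@mpolyC m C) v h = 0 -> h = 0.
  rewrite vE -V1E; apply: linform_mono_inj.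
  by rewrite V1E row_base_free.
(* If the denominator lacked [mu], the relation [muE] and the independence of [v] would remove it
   from the numerator too, against the choice of [mu]. *)
have Dmu : tD@_mu != 0.
  apply: contraTneq muS => Dmu; rewrite mem_cat negb_or -!mcoeff_eq0 Dmu eqxx /=.
  by rewrite (v_inj tQ@_mu) ?eqxx // -muE Dmu rmorph0 mul0r.
exists tD@_mu, tQ@_mu; split.
  move=> /(vanish_eqmx (eqmx_sym rbE))/vanish_pull; rewrite -vE => /v_inj.
  by move/eqP; rewrite (negPf Dmu).
apply: (vanish_eqmx rbE); apply/vanish_pullX.
by rewrite -!vE -mono_face.
Qed.

End FaceDegeneration.
End Face.

(** * Faces and slices of the index set *)

Definition qi_nat k (n : 'I_k -> nat) (S : {set cells n}) :
    'M[nat]_(#|{: {j : 'I_k & 'I_(n j)}}|, #|S|) :=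
  \matrix_(r, c) ((enum_val c : cells n) (tag (enum_val r)) == tagged (enum_val r) : nat).

Section SetFaces.
Variables (R : realType) (k : nat) (n : 'I_k -> nat).
Implicit Type S : {set cells n}.

Lemma qi_mxE S : qi_mx S R = natmx R (qi_nat S).
Proof. by apply/matrixP => i j; rewrite !mxE. Qed.

(** Labels of block [j0] other than [l0] get weight 1, everything else weight 0. A cell has one
    label in that block, so its weight is 0 or 1, and 0 exactly on the face. *)
Lemma rational_mle_setface S (j0 : 'I_k) (l0 : 'I_(n j0)) :
  rational_mle (qi_mx S R) -> rational_mle (qi_mx [set x in S | x j0 == l0] R).
Proof.
set S' := [set x in S | _]; rewrite !qi_mxE => ratS.
have S'S (c : 'I_#|S'|) : (enum_val c : cells n) \in S.
  by have := enum_valP c; rewrite inE => /andP[].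
pose f (c : 'I_#|S'|) : 'I_#|S| := enum_rank_in (S'S c) (enum_val c).
have fK c : enum_val (f c) = enum_val c by rewrite /f enum_rankK_in.
have -> : qi_nat S' = colsub f (qi_nat S).
  by apply/matrixP => r c; rewrite !mxE fK.
pose g' (x : {j : 'I_k & 'I_(n j)}) : nat := (tag x == j0) && (x != Tagged _ l0).
have wE c : (\sum_i g' (enum_val i) * qi_nat S i c = ((enum_val c : cells n) j0 != l0))%N.
  rewrite (reindex (@enum_rank {j : 'I_k & 'I_(n j)})) /=; last first.
    by exists enum_val => x _; rewrite ?enum_rankK ?enum_valK.
  under eq_bigr => x _ do rewrite mxE enum_rankK.
  set y : cells n := enum_val c.
  rewrite (bigD1 (Tagged _ (y j0))) //= eqxx muln1 big1 ?addn0.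
    by rewrite /g' eqxx /= eq_Tagged.
  move=> [j l] /= xy; rewrite /g' /=; case: (y j =P l) => [yl|_]; last by rewrite muln0.
  have [e|//] := eqVneq j j0; case/eqP: xy; rewrite -yl.
  by move: {l yl}j e => j ->.
apply: (rational_mle_face (g := fun i => g' (enum_val i))) ratS => [c|c d|c].
- by rewrite wE; case: (_ != _).
- by move=> /(congr1 enum_val); rewrite !fK => /enum_val_inj.
- rewrite wE eqb0 negbK; apply/idP/idP => [cl|/codomP[c' ->]].
    have cS' : enum_val c \in S' by rewrite inE enum_valP.
    apply/codomP; exists (enum_rank_in cS' (enum_val c)).
    by apply: enum_val_inj; rewrite fK enum_rankK_in.
  by have := enum_valP c'; rewrite fK inE => /andP[].
Qed.

Section Slice.
Variables (S : {set cells n}) (a b : 'I_k).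
Variable i : forall j : {j : 'I_k | (j != a) && (j != b)}, 'I_(n (val j)).
Arguments i : clear implicits.

Lemma rational_mle_fiber : rational_mle (qi_mx S R) ->
  rational_mle (qi_mx [set x in S | [forall j, (x : cells n) (val j) == i j]] R).
Proof.
move=> ratS.
have H (T : seq {j : 'I_k | (j != a) && (j != b)}) :
    rational_mle (qi_mx [set x in S | all (fun j => (x : cells n) (val j) == i j) T] R).
  elim: T => [|t T IH].
    by have -> : [set x in S | all (fun j => (x : cells n) (val j) == i j) [::]] = S;
      first by apply/setP => x; rewrite inE andbT.
  have := rational_mle_setface (l0 := i t) IH; set U := [set x in _ | _].
  suff -> : U = [set x in S | all (fun j => (x : cells n) (val j) == i j) (t :: T)] by [].
  apply/setP => x; rewrite !inE /= -andbA; congr (_ && _); exact: andbC.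
have := H (enum {: {j : 'I_k | (j != a) && (j != b)}}).
set U := [set x in _ | all _ _].
suff -> : U = [set x in S | [forall j, (x : cells n) (val j) == i j]] by [].
apply/setP => x; rewrite !inE; congr (_ && _).
by apply/allP/forallP => [h j|h j _]; apply: h; rewrite mem_enum.
Qed.

(** Fiber and slice have corresponding columns, but the fiber has extra rows for the fixed
    coordinates. These add nothing to the row space. *)
Lemma rational_mle_slice : rational_mle (qi_mx S R) ->
  rational_mle (qi_mx (slice S i) R).
Proof.
move=> /rational_mle_fiber; set F := [set x in S | _]; rewrite qi_mxE => ratF.
have ex_cell (c : 'I_#|slice S i|) : exists x : 'I_#|F|,
    forall l, (enum_val x : cells n) (tnth [tuple a; b] l) = (enum_val c : cells _) l.
  have := enum_valP c; rewrite inE => /exists_inP[x xS /andP[/forallP xc /forallP xi]].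
  have xF : x \in F by rewrite inE xS; apply/forallP.
  by exists (enum_rank_in xF x) => l; rewrite enum_rankK_in //; apply/eqP; exact: xc.
pose h c := sval (cid (ex_cell c)).
have hE c l : (enum_val (h c) : cells n) (tnth [tuple a; b] l) = (enum_val c : cells _) l.
  by rewrite /h; case: cid.
have Fi (x : 'I_#|F|) j : (enum_val x : cells n) (val j) = i j.
  by have := enum_valP x; rewrite inE => /andP[_ /forallP/(_ j)/eqP].
have cell_eq (x y : cells n) : (forall l, x (tnth [tuple a; b] l) = y (tnth [tuple a; b] l)) ->
    (forall j : {j : 'I_k | (j != a) && (j != b)}, x (val j) = y (val j)) -> x = y.
  move=> xy1 xy2; apply/ffunP => j.
  have [-> |ja] := eqVneq j a; first exact: (xy1 ord0).
  have [-> |jb] := eqVneq j b; first exact: (xy1 (lift ord0 ord0)).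
  have jab : (j != a) && (j != b) by rewrite ja.
  exact: (xy2 (exist _ j jab)).
have ratFh : rational_mle (natmx R (colsub h (qi_nat F))).
  (* With all weights zero the face is everything, and the face lemma merely renames the columns
     along the bijection [h]. *)
  apply: (rational_mle_face (g := fun=> 0%N)) ratF => [c|c d hcd|x].
  - by rewrite big1.
  - by apply: enum_val_inj; apply/ffunP => l; rewrite -!hE hcd.
  - rewrite big1 //; apply/esym/codomP.
    pose y : cells (slice_size n a b) := [ffun l => (enum_val x : cells n) (tnth [tuple a; b] l)].
    have yS : y \in slice S i.
      rewrite inE; apply/exists_inP; exists (enum_val x).
        by have := enum_valP x; rewrite inE => /andP[].
      by apply/andP; split; apply/forallP => l; [rewrite ffunE|rewrite Fi].
    exists (enum_rank_in yS y); apply: enum_val_inj; apply: cell_eq => [l|j].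
      by rewrite hE enum_rankK_in // ffunE.
    by rewrite !Fi.
apply: rational_mle_eqmx ratFh; apply/eqmxP/andP; split; apply/row_subP => r.
  have rowE l (v : 'I_(n (tnth [tuple a; b] l))) :
      (row (enum_rank (Tagged (fun j => 'I_(n j)) v)) (natmx R (colsub h (qi_nat F)))
        <= qi_mx (slice S i) R)%MS.
    apply: (eq_row_sub (enum_rank (Tagged (fun l => 'I_(slice_size n a b l)) (v : 'I_(slice_size n a b l))))).
    by apply/rowP => c; rewrite !mxE !enum_rankK /= hE.
  rewrite -(enum_valK r); case: (enum_val r) => j v.
  have [ja|ja] := eqVneq j a.
    by subst j; apply: (rowE ord0).
  have [jb|jb] := eqVneq j b.
    by subst j; apply: (rowE (lift ord0 ord0)).
  have jab : (j != a) && (j != b) by rewrite ja.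
  have iE c : (enum_val (h c) : cells n) j = i (exist _ j jab) by apply: (Fi _ (exist _ j jab)).
  (* A row of a fixed coordinate is all ones for the prescribed label and zero for any other; the
     all-ones row is the sum of a block of the slice. *)
  have [vi|vi] := eqVneq v (i (exist _ j jab)); last first.
    rewrite [X in (X <= _)%MS](_ : _ = 0) ?sub0mx //.
    by apply/rowP => c; rewrite !mxE enum_rankK /= iE eq_sym (negPf vi).
  rewrite [X in (X <= _)%MS](_ : _ = \sum_(w : 'I_(slice_size n a b ord0))
     row (enum_rank (Tagged (fun l => 'I_(slice_size n a b l)) w)) (qi_mx (slice S i) R)).
    by apply: summx_sub => w _; apply: row_sub.
  apply/rowP => c; rewrite !mxE enum_rankK /= iE vi eqxx summxE.
  rewrite (bigD1 ((enum_val c : cells _) ord0)) //= big1 ?addr0.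
    by rewrite !mxE enum_rankK /= eqxx.
  by move=> w wc; rewrite !mxE enum_rankK /= eq_sym (negPf wc).
rewrite -(enum_valK r); case: (enum_val r) => l v.
apply: (eq_row_sub (enum_rank (Tagged (fun j => 'I_(n j)) (v : 'I_(n (tnth [tuple a; b] l)))))).
by apply/rowP => c; rewrite !mxE !enum_rankK /= hE.
Qed.

End Slice.
End SetFaces.

(** * Critical points and multiplicities *)

Section Ideals.
Variable A : comNzRingType.
Implicit Type J : A -> Prop.

Definition is_ideal J :=
  [/\ J 0, forall x y, J x -> J y -> J (x + y) & forall z x, J x -> J (z * x)].

Lemma ideal_colon J h : is_ideal J -> is_ideal (fun x => J (h * x)).
Proof.
case=> J0 JD JM; split=> [|x y|z x]; rewrite ?mulr0 ?mulrDr //; first exact: JD.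
by rewrite mulrCA; apply: JM.
Qed.

Lemma ideal_sub J x y : is_ideal J -> J x -> J y -> J (x - y).
Proof. by case=> J0 JD JM Jx Jy; apply: JD => //; rewrite -mulN1r; apply: JM. Qed.

Lemma ideal_sum J (I : finType) (F : I -> A) : is_ideal J ->
  (forall i, J (F i)) -> J (\sum_i F i).
Proof. by case=> J0 JD JM JF; apply: (big_ind J). Qed.

Lemma ideal_congM J x x' y y' : is_ideal J ->
  J (x - x') -> J (y - y') -> J (x * y - x' * y').
Proof.
case=> J0 JD JM Jx Jy.
have -> : x * y - x' * y' = y * (x - x') + x' * (y - y').
  by rewrite !mulrBr addrA [y * x]mulrC [y * x']mulrC subrK.
by apply: JD; apply: JM.
Qed.

Lemma ideal_congX J x x' e : is_ideal J -> J (x - x') -> J (x ^+ e - x' ^+ e).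
Proof.
move=> idJ Jx; elim: e => [|e IH]; first by rewrite !expr0 subrr; case: idJ.
by rewrite !exprS; apply: ideal_congM.
Qed.

Lemma ideal_cong_mmap J n (R : comNzRingType) (f : {rmorphism R -> A})
    (h h' : 'I_n -> A) p : is_ideal J ->
  (forall i, J (h i - h' i)) -> J (mmap f h p - mmap f h' p).
Proof.
move=> idJ Jh; rewrite /mmap -sumrB; case: (idJ) => J0 JD JM.
apply: (big_ind J) => // mu _; rewrite -mulrBr; apply: JM; rewrite /mmap1.
apply: (big_ind2 (fun x y => J (x - y))) => [|x x' y y' Jx Jy|i _]; first by rewrite subrr.
  exact: ideal_congM.
exact: ideal_congX.
Qed.

End Ideals.

Section Multiplicity.
Variables (F : fieldType) (m : nat) (J : {mpoly F[m]} -> Prop) (p : 'rV[F]_m).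

(** The maximal ideal of the local ring of [J] at [p] is zero, so this ring is the residue field or
    zero. *)
Definition reduced_at :=
  forall q : {mpoly F[m]}, q.@[p 0] = 0 -> exists2 h, h.@[p 0] != 0 & J (h * q).

(** Modulo the colon ideal of [J] by [h] every coordinate equals its value at [p], hence so does
    every polynomial. *)
Lemma reduced_atP (h : {mpoly F[m]}) : is_ideal J -> h.@[p 0] != 0 ->
  (forall c, J (h * ('X_c - (p 0 c)%:MP))) -> reduced_at.
Proof.
move=> idJ hp Jh q qp; exists h => //.
have := @ideal_cong_mmap _ _ m F (@mpolyC m F) (fun i => 'X_i) (fun i => (p 0 i)%:MP) q
  (ideal_colon h idJ) Jh.
have -> : mmap (@mpolyC m F) (fun i => 'X_i) q = q.
  by rewrite -[RHS]comp_mpoly_id; apply: eq_mmap => // i; rewrite tnth_mktuple.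
have -> : mmap (@mpolyC m F) (fun i => (p 0 i)%:MP) q = (q.@[p 0])%:MP.
  by rewrite -[RHS]/(mpolyC m _) (rmorph_mmap _ (@mpolyC m F)); apply: eq_mmap.
by rewrite qp mpolyC0 subr0.
Qed.

(** A combination of the [b i] whose value at [p] is zero represents zero locally, so uniqueness of
    coordinates makes the values of the [b i] linearly independent. Two scalars are never
    independent over [F]. *)
Lemma reduced_multiplicity_le1 d : reduced_at -> has_multiplicity J p d -> (d <= 1)%N.
Proof.
move=> red [b bP]; rewrite leqNgt; apply/negP => d1.
have zero (c : 'rV[F]_d) : \sum_i c 0 i * (b i).@[p 0] = 0 -> c = 0.
  move=> c0; have one : (1 : {mpoly F[m]}).@[p 0] != 0 by rewrite meval1 oner_neq0.
  have [e [_ e_uniq]] := bP 0 1 one.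
  have uniq0 (c' : 'rV[F]_d) : \sum_i c' 0 i * (b i).@[p 0] = 0 -> e = c'.
    move=> c'0; apply: e_uniq; apply: red.
    rewrite mevalB meval0 mul1r rmorph_sum sub0r /=.
    by under eq_bigr => i _ do rewrite mevalZ; rewrite c'0 oppr0.
  by rewrite -(uniq0 c c0); apply: uniq0; apply: big1 => i _; rewrite mxE mul0r.
pose i0 := Ordinal (ltnW d1); pose i1 := Ordinal d1.
have i10 : i1 != i0 by [].
have sum_delta (x y : F) : \sum_i (x *: delta_mx 0 i0 + y *: delta_mx 0 i1 : 'rV[F]_d) 0 i * (b i).@[p 0]
    = x * (b i0).@[p 0] + y * (b i1).@[p 0].
  rewrite (bigD1 i0) //= (bigD1 i1) //= big1 ?addr0.
    by rewrite !mxE /= !mulr0 !mulr1 addr0 add0r.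
  by move=> i /andP[ii0 ii1]; rewrite !mxE (negPf ii0) (negPf ii1) !mulr0 addr0 mul0r.
have b00 : (b i1).@[p 0] = 0.
  have /zero : \sum_i ((b i1).@[p 0] *: delta_mx 0 i0 + (- (b i0).@[p 0]) *: delta_mx 0 i1 : 'rV[F]_d) 0 i * (b i).@[p 0] = 0.
    by rewrite sum_delta mulNr mulrC subrr.
  by move=> /rowP/(_ i0); rewrite !mxE /= mulr0 addr0 mulr1.
have /zero : \sum_i (0 *: delta_mx 0 i0 + 1 *: delta_mx 0 i1 : 'rV[F]_d) 0 i * (b i).@[p 0] = 0.
  by rewrite sum_delta b00 mul0r mulr0 addr0.
move=> /rowP/(_ i1); rewrite !mxE /= mulr0 add0r mulr1 => /eqP.
by rewrite oner_eq0.
Qed.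

Lemma reduced_multiplicity1 : reduced_at -> (forall f, J f -> f.@[p 0] = 0) ->
  has_multiplicity J p 1.
Proof.
move=> red Jp; exists (fun=> 1) => f g gp.
have ev (c : 'rV[F]_1) : (f - g * \sum_i c 0 i *: 1).@[p 0] = f.@[p 0] - g.@[p 0] * c 0 0.
  by rewrite mevalB mevalM big_ord1 mevalZ meval1 mulr1.
exists (const_mx (f.@[p 0] / g.@[p 0])); split.
  by apply: red; rewrite ev mxE mulrCA divff // mulr1 subrr.
move=> c [h hp /Jp]; rewrite mevalM ev => /eqP; rewrite mulf_eq0 (negPf hp) subr_eq0 /=.
move=> /eqP ->; apply/rowP => j; rewrite mxE ord1.
by rewrite mulrC mulKf.
Qed.

End Multiplicity.

(** * Homogenization and the likelihood equations *)

Section Homogenize.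
Variables (N : nat) (K : comNzRingType).

(** A division-free form of d^e p(y / d), for e at least the degree of p. It serves with [d] the sum
    of the coordinates and with [d] a common denominator. *)
Definition homogenize (B : comNzRingType) (f : K -> B) e (d : B) (y : 'I_N -> B)
    (p : {mpoly K[N]}) : B :=
  \sum_(mu <- msupp p) f p@_mu * (d ^+ (e - mdeg mu) * \prod_i y i ^+ mu i).

Lemma homogenizeE (B : comNzRingType) (f : K -> B) e d (x y : 'I_N -> B) p :
  (msize p <= e.+1)%N -> (forall i, y i = d * x i) ->
  homogenize f e d y p = d ^+ e * mmap f x p.
Proof.
move=> pe yE; rewrite /mmap mulr_sumr /homogenize big_seq [RHS]big_seq.
apply: eq_bigr => mu mup; rewrite [RHS]mulrCA; congr (_ * _).
have mue : (mdeg mu <= e)%N by rewrite -ltnS; apply: leq_trans pe; apply: msize_mdeg_lt.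
rewrite -[in RHS](subnK mue) exprD -mulrA; congr (_ * _).
rewrite mdegE -prodrXr -big_split; apply: eq_bigr => i _ /=.
by rewrite yE exprMn.
Qed.

Lemma rmorph_homogenize (B B' : comNzRingType) (f : K -> B) (g : {rmorphism B -> B'}) e d y p :
  g (homogenize f e d y p) = homogenize (g \o f) e (g d) (g \o y) p.
Proof.
rewrite /homogenize rmorph_sum; apply: eq_bigr => mu _.
rewrite !rmorphM rmorphXn rmorph_prod; congr (_ * (_ * _)).
by apply: eq_bigr => i _; rewrite rmorphXn.
Qed.

End Homogenize.

Section Likelihood.
Variables (R : realType) (k : nat) (n : 'I_k -> nat) (S : {set cells n}) (j0 : 'I_k).
Local Notation C := (complex R).
Local Notation "x %:CC" := (real_complex R x) (at level 2, format "x %:CC").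
Local Notation N := #|S|.
Local Notation A := (qi_mx S R).

(** Every cell has exactly one label in block [j0]. Hence the cone is stable under scaling, and the
    sum of the coordinates is among the moment coordinates up to linear combination. *)
Lemma qi_mx_ones : (const_mx 1 : 'rV[R]_N) = \sum_(l : 'I_(n j0))
  row (enum_rank (Tagged (fun j => 'I_(n j)) l)) A.
Proof.
apply/rowP => c; rewrite mxE summxE (bigD1 ((enum_val c : cells n) j0)) //= big1 ?addr0.
  by rewrite !mxE enum_rankK /= eqxx.
by move=> l lc; rewrite !mxE enum_rankK /= eq_sym (negPf lc).
Qed.

Lemma cone_scale t (p : 'rV[R]_N) : 0 < t -> cone A p -> cone A (t *: p).
Proof.
move=> t0 [p0 pA]; split=> [c|]; first by rewrite mxE mulr_gt0.
have -> : map_mx (@exp.ln R) (t *: p) = map_mx (@exp.ln R) p + exp.ln t *: const_mx 1.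
  by apply/rowP => c; rewrite !mxE exp.lnM ?posrE // mulr1 addrC.
apply: addmx_sub => //; apply: scalemx_sub; rewrite qi_mx_ones.
by apply: summx_sub => l _; apply: row_sub.
Qed.

Lemma qi_model_normalize (p : 'rV[R]_N) : (0 < N)%N -> cone A p ->
  0 < \sum_c p 0 c /\ qi_model ((\sum_c p 0 c)^-1 *: p).
Proof.
move=> N0 coneAp; have [p0 _] := coneAp.
have s0 : 0 < \sum_c p 0 c.
  rewrite (bigD1 (Ordinal N0)) //=; apply: ltr_wpDr => //.
  by apply: sumr_ge0 => c _; apply: ltW.
have [q0 qA] : cone A ((\sum_c p 0 c)^-1 *: p) by apply: cone_scale; rewrite ?invr_gt0.
split=> //; split=> //; under eq_bigr => c _ do rewrite mxE.
by rewrite -mulr_sumr mulVf // gt_eqF.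
Qed.

Definition dilate (t : C) (f : {mpoly C[N]}) : {mpoly C[N]} :=
  mmap (@mpolyC N C) (fun c => t *: 'X_c) f.

Lemma meval_dilate t f v : (dilate t f).@[v] = f.@[fun c => t * v c].
Proof.
by rewrite mmap_mpolyC_meval; apply: meval_eq => c; rewrite mevalZ mevalXU.
Qed.

(* As 1 is a sum of rows of A_S, the cone over the model is stable under dilation. *)
Lemma vanish_dilate t f : vanish A f -> qi_ideal (dilate t f).
Proof.
move=> fA p [p0 _ pA]; rewrite meval_dilate.
(* Only positive real dilations preserve the cone. The polynomial [h] in the dilation factor
   vanishes at all positive integers, hence identically, which covers complex [t]. *)
pose h := mmap (@polyC C) (fun c : 'I_N => ((p 0 c)%:CC)%:P * 'X) f.
have hE (s : C) : h.[s] = f.@[fun c => s * (p 0 c)%:CC].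
  rewrite -[LHS]/(horner_eval s h) /h (rmorph_mmap _ (horner_eval s)).
  by apply: eq_mmap => c /=; rewrite /horner_eval ?hornerM ?hornerC ?hornerX 1?mulrC.
have h0 : h = 0.
  apply: contrapT => /eqP /poly_neq0_pt[l]; apply/negP; rewrite negbK hE.
  have := fA (l.+1%:R *: p) (cone_scale (ltr0Sn _ l) (conj p0 pA)).
  move=> E; apply/eqP; rewrite -[RHS]E; apply: meval_eq => c.
  by rewrite !mxE rmorphM rmorph_nat.
have := hE t; rewrite h0 horner0 => E; rewrite [RHS]E; apply: meval_eq => c.
by rewrite mxE.
Qed.

(** At a point of the cone the value is a power of the sum s of the coordinates times the value of
    [f] at p / s, a point of the model. *)
Lemma qi_ideal_homogenize f e : (0 < N)%N -> (msize f <= e.+1)%N -> qi_ideal f ->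
  vanish A (homogenize (@mpolyC N C) e (\sum_c 'X_c) (fun c => 'X_c) f).
Proof.
move=> N0 fe fI p cp; have [s0 mp] := qi_model_normalize N0 cp.
set q := map_mx _ p 0; rewrite (rmorph_homogenize _ (meval q)).
have qE c : q c = (p 0 c)%:CC by rewrite /q mxE.
have sE : (\sum_c 'X_c : {mpoly C[N]}).@[q] = (\sum_c p 0 c)%:CC.
  by rewrite !rmorph_sum; apply: eq_bigr => c _; rewrite /= mevalXU qE.
rewrite (@homogenizeE _ _ _ _ _ _ (fun c => ((\sum_c p 0 c)^-1 * p 0 c)%:CC)) //.
  rewrite (eq_mmap (g := idfun) (k := map_mx (real_complex R) ((\sum_c p 0 c)^-1 *: p) 0)).
  - by rewrite -/(meval _ f) (fI _ mp) mulr0.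
  - by move=> x; rewrite /= mevalC.
  - by move=> c; rewrite !mxE.
by move=> c; rewrite /= mevalXU qE sE -rmorphM mulrA divff ?mul1r // gt_eqF.
Qed.

Lemma qi_mx_map : qi_mx S C = map_mx (real_complex R) A.
Proof. by apply/matrixP => r c; rewrite !mxE rmorph_nat. Qed.

Lemma qi_ideal_is_ideal : is_ideal (@qi_ideal k n S R).
Proof.
split=> [p _|f g fI gI p mp|f g gI p mp]; first by rewrite meval0.
  by rewrite mevalD fI ?gI ?addr0.
by rewrite mevalM gI // mulr0.
Qed.

Variable u : 'rV[C]_N.
Let t := Defs.total u.
Let y r := (qi_mx S C *m u^T) r 0.
Let J := critical_ideal u.

Lemma critical_ideal_is_ideal : is_ideal J.
Proof.
have [I0 ID IM] := qi_ideal_is_ideal; split.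
- exists 0 => //; exists (fun=> 0); rewrite big1 ?addr0 // => r _; exact: mul0r.
- move=> _ _ [f fI [q ->]] [g gI [q' ->]]; exists (f + g); first exact: ID.
  exists (fun r => q r + q' r); rewrite addrACA -big_split; congr (_ + _).
  by apply: eq_bigr => r _; rewrite /= mulrDl.
- move=> z _ [f fI [q ->]]; exists (z * f); first exact: IM.
  exists (fun r => z * q r); rewrite mulrDr mulr_sumr; congr (_ + _).
  by apply: eq_bigr => r _; rewrite mulrA.
Qed.

Lemma likelihood_eq_mem r : J (likelihood_eq u r).
Proof.
exists 0; first by case: qi_ideal_is_ideal.
exists (fun r' => (r' == r)%:R); rewrite add0r (bigD1 r) //= eqxx mul1r big1 ?addr0 //.
by move=> r' /negPf ->; rewrite mul0r.
Qed.

Lemma qi_ideal_sub f : qi_ideal f -> J f.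
Proof.
move=> fI; exists f => //; exists (fun=> 0); rewrite big1 ?addr0 // => r _.
exact: mul0r.
Qed.

Lemma critical_ideal_vanish p f : critical u p -> J f -> f.@[p 0] = 0.
Proof.
move=> [pcl _ _ pA] [g gI [q ->]]; rewrite mevalD (pcl _ gI) add0r rmorph_sum.
apply: big1 => r _; rewrite /= mevalM /likelihood_eq mevalB mevalC mevalZ.
rewrite pA mxE [X in _ - X](_ : _ = Defs.total u * (qi_mx S C *m p^T) r 0) ?subrr ?mulr0 //.
congr (_ * _); rewrite mxE rmorph_sum; apply: eq_bigr => c _.
by rewrite /= mevalZ mevalXU [p^T _ _]mxE.
Qed.

Lemma critical_vanish p f : critical u p -> vanish A f -> f.@[fun c => t * p 0 c] = 0.
Proof. by move=> [pcl _ _ _] fA; rewrite -meval_dilate; apply/pcl/vanish_dilate. Qed.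

Lemma critical_pull p f : critical u p -> (pull A f).@[fun c => t * p 0 c] = f.@[y].
Proof.
move=> [_ _ _ pA]; rewrite meval_pull; apply: meval_eq => r; rewrite /y pA mxE mxE mulr_sumr.
by apply: eq_bigr => c _; rewrite qi_mx_map !mxE mulrCA.
Qed.

(** The counterpart of [critical_pull] modulo the critical ideal, where the likelihood equations
    identify t A X with A u. Multiplicities need this form. *)
Lemma dilate_pull_cong f : J (dilate t (pull A f) - (f.@[y])%:MP).
Proof.
rewrite /dilate (mmap_pull A (fun c => t *: 'X_c) f).
have -> : (f.@[y])%:MP = mmap (@mpolyC N C) (fun r => (y r)%:MP) f.
  by rewrite -[LHS]/(mpolyC N _) (rmorph_mmap _ (@mpolyC N C)); apply: eq_mmap.
apply: ideal_cong_mmap; first exact: critical_ideal_is_ideal.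
move=> r; have [_ _ JM] := critical_ideal_is_ideal.
have := JM (-1) _ (likelihood_eq_mem r); congr J.
rewrite mulN1r /likelihood_eq opprB scaler_sumr; congr (_ - _).
by apply: eq_bigr => c _; rewrite qi_mx_map [map_mx _ _ _ _]mxE !scalerA mulrC.
Qed.

Lemma vanish_pullX_cong f g c : vanish A (pull A f * 'X_c - pull A g) ->
  J ((f.@[y])%:MP * (t *: 'X_c) - (g.@[y])%:MP).
Proof.
have dilateE F G : dilate t (F * 'X_c - G) = dilate t F * (t *: 'X_c) - dilate t G.
  by rewrite /dilate mmapB (rmorphM (mmap _ _)) /= mmapX mmap1U.
have := dilate_pull_cong g; have := dilate_pull_cong f.
move: (pull A f) (pull A g) => F G JF JG H.
have := qi_ideal_sub (vanish_dilate t H); rewrite (dilateE F G).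
move: (dilate t F) (dilate t G) JF JG => dF dG JF JG JH.
have idJ := critical_ideal_is_ideal; have [J0 JD JM] := idJ.
have JX : J (t *: 'X_c - t *: 'X_c) by rewrite subrr.
have := JD _ _ (ideal_sub idJ JH (ideal_congM idJ JF JX)) JG.
by congr J; ring.
Qed.

End Likelihood.

(** * The degree bound in the rational case *)

Section RationalDegree.
Variables (R : realType) (k : nat) (n : 'I_k -> nat) (S : {set cells n}) (j0 : 'I_k).
Local Notation C := (complex R).
Local Notation N := #|S|.
Local Notation A := (qi_mx S R).

Lemma vanish0 : vanish A (0 : {mpoly C[N]}).
Proof. by move=> p _; rewrite meval0. Qed.

Definition total_mpoly : {mpoly C[N]} := \sum_c 'X_c.

Lemma meval_total (u : 'rV[C]_N) : total_mpoly.@[u 0] = Defs.total u.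
Proof. by rewrite rmorph_sum; apply: eq_bigr => c _; rewrite /= mevalXU. Qed.

Lemma total_mpoly_neq0 : (0 < N)%N -> total_mpoly != 0.
Proof.
move=> N0; apply/eqP => /(congr1 (mcoeff U_(Ordinal N0))).
rewrite mcoeff0 raddf_sum /= (bigD1 (Ordinal N0)) //= mcoeffXU eqxx big1.
  by move/eqP; rewrite addr0 oner_eq0.
by move=> c /negPf c0; rewrite mcoeffXU c0.
Qed.

Lemma meval_pull_data f (u : 'rV[C]_N) :
  (pull A f).@[u 0] = f.@[fun r => (qi_mx S C *m u^T) r 0].
Proof.
rewrite meval_pull; apply: meval_eq => r; rewrite mxE.
by apply: eq_bigr => c _; rewrite qi_mx_map [map_mx _ _ _ _]mxE [u^T _ _]mxE.
Qed.

Lemma mpoly_neq0_vec (h : {mpoly C[N]}) : h != 0 -> exists u : 'rV[C]_N, h.@[u 0] != 0.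
Proof.
move=> /mpoly_neq0_pt[v _ hv]; exists (\row_i (v i)%:R).
by rewrite (meval_eq (v2 := fun i => (v i)%:R)) // => i; rewrite mxE.
Qed.

(** One [u] off the given hypersurface and off the zeros of the total and of all denominators
    suffices. There p_c is determined by A u, so at most one critical point exists; the same
    equations modulo the critical ideal have invertible constants and show that it is reduced. *)
Lemma rational_mle_degree d : rational_mle A -> has_ml_degree R S d -> (d <= 1)%N.
Proof.
move=> ratA [h h0 hd].
case: (posnP N) => N0.
  have [u hu] := mpoly_neq0_vec h0.
  have [s [mu [_ scrit _ ->]]] := hd u hu.
  have -> : s = [::].
    case: s scrit => // p s scrit; have [_ tp _ _] := (scrit p).1 (mem_head _ _).
    case/eqP: (oner_neq0 C); rewrite -tp; apply: big1 => c _.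
    by have := ltn_ord c; rewrite {2}N0.
  by rewrite big_nil.
have /choice[D /choice[Q DQ]] := ratA.
pose w := total_mpoly * \prod_c pull A (D c).
have w0 : w != 0.
  rewrite mulf_neq0 ?total_mpoly_neq0 //; apply/prodf_neq0 => c _.
  by apply/eqP => D0; apply: (DQ c).1; rewrite D0; apply: vanish0.
have [u] := mpoly_neq0_vec (mulf_neq0 h0 w0).
rewrite mevalM mulf_eq0 negb_or => /andP[hu]; rewrite mevalM mulf_eq0 negb_or meval_total.
move=> /andP[t0]; rewrite rmorph_prod => /prodf_neq0 Du.
set t := Defs.total u in t0; pose y r := (qi_mx S C *m u^T) r 0.
have {}Du c : (D c).@[y] != 0 by have := Du c isT; rewrite /= meval_pull_data.
have critE p : critical u p -> forall c, (D c).@[y] * (t * p 0 c) = (Q c).@[y].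
  move=> cp c; have := critical_vanish j0 cp (DQ c).2.
  have := critical_pull (Q c) cp; have := critical_pull (D c) cp.
  move: (pull A (D c)) (pull A (Q c)) => F G EF EG.
  by rewrite mevalB mevalM mevalXU EF EG => /eqP; rewrite subr_eq0 => /eqP.
have [s [mu [us scrit smu ->]]] := hd u hu.
have one p q : p \in s -> q \in s -> p = q.
  move=> /scrit/critE pE /scrit/critE qE; apply/rowP => c.
  by apply: (mulfI t0); apply: (mulfI (Du c)); rewrite pE qE.
have mu1 p : p \in s -> (mu p <= 1)%N.
  move=> ps; have cp := (scrit p).1 ps; apply: reduced_multiplicity_le1 (smu p ps).
  have idJ := critical_ideal_is_ideal u; have [J0 JD JM] := idJ.
  apply: (reduced_atP idJ (h := 1)) => [|c]; first by rewrite meval1 oner_neq0.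
  have := vanish_pullX_cong j0 u (DQ c).2; rewrite -/y -(critE p cp c) -/t.
  have -> : ((D c).@[y])%:MP * (t *: 'X_c) - ((D c).@[y] * (t * p 0 c))%:MP =
      ((D c).@[y] * t)%:MP * ('X_c - (p 0 c)%:MP).
    by rewrite !mpolyCM -!mul_mpolyC; ring.
  move=> /(JM ((((D c).@[y] * t)^-1)%:MP)); rewrite mulrA -mpolyCM mulVf ?mul1r //.
  by rewrite mulf_neq0.
case: s us one mu1 {scrit smu} => [|p [|q s]] us one mu1; first by rewrite big_nil.
  by rewrite big_seq1 mu1 ?mem_head.
have := one p q (mem_head _ _); rewrite inE mem_head orbT => /(_ isT) pq.
by move: us; rewrite pq /= inE eqxx.
Qed.

End RationalDegree.

(** * The generic fibre *)

Lemma separable_roots (F : closedFieldType) (p q1 q2 : {poly F}) (a : F) :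
  a != 0 -> q1 * p + q2 * p^`() = a%:P -> p != 0 ->
  exists rs : seq F, [/\ uniq rs, size rs = (size p).-1 & forall x, (x \in rs) = root p x].
Proof.
move=> a0 E p0; have [rs pE] := closed_field_poly_normal p.
have lc0 : lead_coef p != 0 by rewrite lead_coef_eq0.
exists rs; split.
- rewrite -separable.separable_prod_XsubC separable.separable_poly.unlock.
  rewrite -(coprimepZl _ _ lc0) -(coprimepZr _ _ lc0); apply/Bezout_eq1_coprimepP; exists (a^-1 *: q1, a^-1 *: q2) => /=.
  rewrite -derivZ -pE -!scalerAl -scalerDr E -mul_polyC -polyCM mulVf //.
- by rewrite [in RHS]pE size_scale // size_prod_XsubC.
- by move=> x; rewrite [in RHS]pE rootZ // root_prod_XsubC.
Qed.

Lemma ideal_cong_horner (A : comNzRingType) (J : A -> Prop) (p : {poly A}) x y :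
  is_ideal J -> J (x - y) -> J (p.[x] - p.[y]).
Proof.
move=> idJ Jxy; rewrite !horner_coef -sumrB; apply: ideal_sum => // i.
by rewrite -mulrBr; case: (idJ) => _ _; apply; apply: ideal_congX.
Qed.

Section Fiber.
Variables (R : realType) (k : nat) (n : 'I_k -> nat) (S : {set cells n}) (j0 : 'I_k).
Local Notation C := (complex R).
Local Notation "x %:CC" := (real_complex R x) (at level 2, format "x %:CC").
Local Notation N := #|S|.
Local Notation A := (qi_mx S R).
Hypothesis N_gt0 : (0 < N)%N.
Variables (r : nat) (fr : 'I_r -> 'I_(#|{: {j : 'I_k & 'I_(n j)}}|)).
Local Notation E := (rowsub fr A).
Hypothesis A_sub_E : (A <= E)%MS.
(** [kap] restricts polynomials to the cone, [pl] substitutes the linear forms of [E], and [phi]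
    embeds C[b] in the functions on the cone. [Th] represents the primitive element theta, with
    minimal polynomial [M], and [D], [Q] express the coordinates through it. *)
Variables (B : idomainType) (kap : {rmorphism {mpoly C[N]} -> B}).
Hypothesis kapP : forall f, vanish A f <-> kap f = 0.
Variables (pl : {rmorphism {mpoly C[r]} -> {mpoly C[N]}}).
Hypothesis plE : forall f, pl f = pull A (mmap (@mpolyC _ C) (fun i => 'X_(fr i)) f).
Variable phi : {rmorphism {mpoly C[r]} -> B}.
Hypothesis plC : forall x, pl x%:MP = x%:MP.
Hypothesis plX : forall i, pl 'X_i = linform E (fun c => 'X_c) i.
Hypothesis phiE : forall f, phi f = kap (pl f).
Variable z : 'I_N -> int.
Let Th : {mpoly C[N]} := \sum_c 'X_c *~ z c.
Variable M : {poly {mpoly C[r]}}.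
Hypothesis M_neq0 : M != 0.
Hypothesis Mt : (map_poly phi M).[kap Th] = 0.
Hypothesis M_min : forall G : {poly {mpoly C[r]}}, G != 0 -> (map_poly phi G).[kap Th] = 0 ->
  (size M <= size G)%N.
Variables (D : {mpoly C[r]}) (Q : 'I_N -> {poly {mpoly C[r]}}).
Hypothesis DQ : forall c, phi D * kap 'X_c = (map_poly phi (Q c)).[kap Th].

Let evp (G : {poly {mpoly C[r]}}) : {mpoly C[N]} := (map_poly pl G).[Th].

Lemma kap_evp G : kap (evp G) = (map_poly phi G).[kap Th].
Proof.
rewrite /evp -horner_map -map_poly_comp; congr (_.[_]).
by apply: eq_map_poly => f; rewrite phiE.
Qed.

Section Data.
Variable u : 'rV[C]_N.
Let t := Defs.total u.
Let y i := (qi_mx S C *m u^T) (fr i) 0.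
Let J := critical_ideal u.
Let psi : {rmorphism {mpoly C[r]} -> C} := meval y.
Let idJ : is_ideal J := critical_ideal_is_ideal u.

Lemma subE f : (mmap (@mpolyC _ C) (fun i => 'X_(fr i)) f).@[fun r => (qi_mx S C *m u^T) r 0] = psi f.
Proof. by rewrite mmap_mpolyC_meval; apply: meval_eq => i; rewrite mevalXU. Qed.

Lemma pl_crit p f : critical u p -> (pl f).@[fun c => t * p 0 c] = psi f.
Proof. by move=> cp; rewrite plE; have := critical_pull (mmap (@mpolyC _ C) (fun i => 'X_(fr i)) f) cp; rewrite subE. Qed.

Lemma pl_cong f : J (dilate t (pl f) - (psi f)%:MP).
Proof. by rewrite plE; have := dilate_pull_cong u (mmap (@mpolyC _ C) (fun i => 'X_(fr i)) f); rewrite subE. Qed.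

Lemma evp_crit p G : critical u p ->
  (evp G).@[fun c => t * p 0 c] = (map_poly psi G).[Th.@[fun c => t * p 0 c]].
Proof.
move=> cp; rewrite /evp -(horner_map (meval _)) -map_poly_comp; congr (_.[_]).
by apply: eq_map_poly => f; rewrite /= pl_crit.
Qed.

Let dilm : {rmorphism {mpoly C[N]} -> {mpoly C[N]}} :=
  mmap (@mpolyC N C) (fun c => t *: 'X_c).

Lemma evp_cong G :
  J (dilate t (evp G) - (map_poly (@mpolyC N C) (map_poly psi G)).[dilate t Th]).
Proof.
have -> : dilate t (evp G) = (map_poly (dilm \o pl) G).[dilate t Th].
  by rewrite map_poly_comp [RHS](horner_map dilm).
rewrite -map_poly_comp.
have szm (g : {rmorphism {mpoly C[r]} -> {mpoly C[N]}}) v :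
    (map_poly g G).[v] = \sum_(i < size G) g G`_i * v ^+ i.
  rewrite (horner_coef_wide _ (size_poly _ _)); apply: eq_bigr => i _.
  by rewrite coef_map.
rewrite !szm -sumrB; apply: ideal_sum => // i; rewrite -mulrBl mulrC.
by case: idJ => _ _; apply; apply: pl_cong.
Qed.

Let Mu : {poly C} := map_poly psi M.
Let Qu c : {poly C} := map_poly psi (Q c).

Lemma crit_root p : critical u p -> root Mu Th.@[fun c => t * p 0 c].
Proof.
move=> cp; apply/rootP; rewrite -(evp_crit _ cp).
by apply: (critical_vanish j0 cp); apply/kapP; rewrite kap_evp.
Qed.

Lemma crit_coord p c : critical u p ->
  psi D * (t * p 0 c) = (Qu c).[Th.@[fun c => t * p 0 c]].
Proof.
move=> cp; rewrite -(evp_crit _ cp) -(pl_crit D cp).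
have : vanish A (pl D * 'X_c - evp (Q c)).
  by apply/kapP; rewrite rmorphB rmorphM -phiE DQ kap_evp subrr.
move=> /(critical_vanish j0 cp); rewrite mevalB mevalM mevalXU => /eqP.
by rewrite subr_eq0 => /eqP.
Qed.

Hypothesis t_neq0 : t != 0.
Hypothesis lcM_neq0 : psi (lead_coef M) != 0.
Hypothesis D_neq0 : psi D != 0.

Section Point.
Variable x : C.
Hypothesis Mx : root Mu x.
Hypothesis Qx_neq0 : forall c, (Qu c).[x] != 0.
Let X c := (Qu c).[x] / psi D.

Lemma transfer G : (map_poly phi G).[kap Th] = 0 -> (map_poly psi G).[x] = 0.
Proof.
by apply: (minimal_poly_specialize M_neq0 Mt M_min lcM_neq0 (rootP Mx)).
Qed.

Lemma evalB_sig : {g : {rmorphism {poly {mpoly C[r]}} -> B} |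
  forall G, g G = (map_poly phi G).[kap Th]}.
Proof. by exists (horner_eval (kap Th) \o map_poly phi). Qed.
Let evalB := sval evalB_sig.
Let evalBE G : evalB G = (map_poly phi G).[kap Th] := svalP evalB_sig G.

Lemma evalC_sig : {g : {rmorphism {poly {mpoly C[r]}} -> C} |
  forall G, g G = (map_poly psi G).[x]}.
Proof. by exists (horner_eval x \o map_poly psi). Qed.
Let evalC := sval evalC_sig.
Let evalCE G : evalC G = (map_poly psi G).[x] := svalP evalC_sig G.

Lemma evalBC f : evalB f%:P = phi f.
Proof. by rewrite evalBE map_polyC hornerC. Qed.

Lemma evalCC f : evalC f%:P = psi f.
Proof. by rewrite evalCE map_polyC hornerC. Qed.

Lemma evalBX : evalB 'X = kap Th.
Proof. by rewrite evalBE map_polyX hornerX. Qed.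

Lemma evalCX : evalC 'X = x.
Proof. by rewrite evalCE map_polyX hornerX. Qed.

Lemma evalBQ c : evalB (Q c) = phi D * kap 'X_c.
Proof. by rewrite evalBE DQ. Qed.

Lemma evalCQ c : evalC (Q c) = psi D * X c.
Proof. by rewrite evalCE /X mulrCA divff // mulr1. Qed.

(** The transport principle for a root [x]: an identity between theta and the coordinates,
    multiplied by a power of [D], is a relation of theta over C[b] and so also holds for [x] and
    [X]. *)
Lemma evalB_evalC G : evalB G = 0 -> evalC G = 0.
Proof. by rewrite evalBE evalCE; apply: transfer. Qed.

(** Homogenizing [f] with [D] turns it into a polynomial in theta equal to a power of [D] times the
    restriction of [f] to the cone. *)
Lemma point_vanish f : vanish A f -> f.@[X] = 0.
Proof.
move=> /kapP f0.
pose F := homogenize (polyC \o @mpolyC r C) (msize f) D%:P Q f.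
have : evalC F = 0.
  apply: evalB_evalC; rewrite /F rmorph_homogenize.
  rewrite (@homogenizeE _ _ _ _ _ _ (fun c => kap 'X_c)) //; last first.
    by move=> c; rewrite /= evalBC evalBQ.
  rewrite (eq_mmap (g := kap \o @mpolyC N C) (k := fun c => kap 'X_c)) //; last first.
    by move=> a /=; rewrite evalBC phiE plC.
  by rewrite -rmorph_mpolyE f0 mulr0.
rewrite /F rmorph_homogenize (@homogenizeE _ _ _ _ _ _ X) //; last first.
  by move=> c; rewrite /= evalCC evalCQ.
rewrite (eq_mmap (g := idfun) (k := X)) //; last by move=> a /=; rewrite evalCC /= mevalC.
by move/eqP; rewrite evalCC mulf_eq0 expf_eq0 (negPf D_neq0) andbF => /eqP.
Qed.

(** The definition of theta as a combination of the coordinates is itself transported. Consequently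
    the point determines the root. *)
Lemma point_Th : Th.@[X] = x.
Proof.
have : evalC (\sum_c Q c *~ z c - D%:P * 'X) = 0.
  apply: evalB_evalC; rewrite rmorphB rmorphM evalBC evalBX rmorph_sum [kap Th]rmorph_sum mulr_sumr.
  rewrite -sumrB big1 // => c _.
  by rewrite !rmorphMz evalBQ mulrzAr subrr.
rewrite rmorphB rmorphM evalCC evalCX rmorph_sum.
have -> : \sum_c evalC (Q c *~ z c) = psi D * Th.@[X].
  rewrite [Th.@[X]]rmorph_sum mulr_sumr; apply: eq_bigr => c _.
  by rewrite !rmorphMz evalCQ /= mevalXU mulrzAr.
by rewrite -mulrBr => /eqP; rewrite mulf_eq0 (negPf D_neq0) subr_eq0 => /eqP.
Qed.

Lemma point_rows i : \sum_c (E i c)%:CC * X c = y i.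
Proof.
have : evalC (\sum_c ((E i c)%:CC%:MP)%:P * Q c - (D * 'X_i)%:P) = 0.
  apply: evalB_evalC; rewrite rmorphB evalBC rmorphM rmorph_sum [phi 'X_i]phiE plX /linform rmorph_sum mulr_sumr.
  rewrite -sumrB big1 // => c _.
  by rewrite rmorphM evalBC evalBQ phiE plC -mul_mpolyC rmorphM mulrCA subrr.
rewrite rmorphB evalCC rmorphM rmorph_sum.
have -> : \sum_c evalC (((E i c)%:CC%:MP)%:P * Q c) = psi D * \sum_c (E i c)%:CC * X c.
  by rewrite mulr_sumr; apply: eq_bigr => c _; rewrite rmorphM evalCC evalCQ /= mevalC mulrCA.
rewrite /= mevalXU -mulrBr => /eqP; rewrite mulf_eq0 (negPf D_neq0) subr_eq0 => /eqP //.
Qed.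

Lemma point_sub (w : 'rV[R]_N) : (w <= E)%MS ->
  \sum_c (w 0 c)%:CC * X c = \sum_c (w 0 c)%:CC * u 0 c.
Proof.
move=> /submxP[v ->].
have wE (f : 'I_N -> C) : \sum_c ((v *m E) 0 c)%:CC * f c = \sum_i (v 0 i)%:CC * \sum_c (E i c)%:CC * f c.
  under eq_bigr => c _ do rewrite mxE rmorph_sum mulr_suml.
  rewrite exchange_big; apply: eq_bigr => i _; rewrite mulr_sumr.
  by apply: eq_bigr => c _; rewrite rmorphM mulrA.
rewrite !wE; apply: eq_bigr => i _; congr (_ * _); rewrite point_rows /y mxE.
by apply: eq_bigr => c _; rewrite qi_mx_map [map_mx _ _ _ _]mxE [rowsub _ _ _ _]mxE [u^T _ _]mxE.
Qed.

Lemma point_total : \sum_c X c = t.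
Proof.
have H : ((const_mx 1 : 'rV[R]_N) <= E)%MS.
  rewrite (qi_mx_ones R S j0) summx_sub // => l _.
  exact: submx_trans (row_sub _ _) A_sub_E.
have := point_sub H; under eq_bigr => c _ do rewrite mxE rmorph1 mul1r.
by under [RHS]eq_bigr => c _ do rewrite mxE rmorph1 mul1r.
Qed.

Let pt : 'rV[C]_N := \row_c (X c / t).

Lemma tpt c : t * pt 0 c = X c.
Proof. by rewrite mxE mulrCA divff // mulr1. Qed.

Lemma point_critical : critical u pt.
Proof.
split.
(* An element of [qi_ideal] need not vanish on the cone, but its homogenization by the total does;
   at [X] the total is t, which is nonzero. *)
- move=> f fI; have := point_vanish (qi_ideal_homogenize j0 N_gt0 (leqnSn _) fI).
  rewrite (rmorph_homogenize _ (meval X)) (@homogenizeE _ _ _ _ _ _ (pt 0)) //; last first.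
    move=> c; rewrite /= mevalXU rmorph_sum -tpt; congr (_ * _).
    by rewrite -[LHS]point_total; apply: eq_bigr => d _; rewrite /= mevalXU.
  rewrite (eq_mmap (g := idfun) (k := pt 0)) //; last by move=> a /=; rewrite mevalC.
  rewrite rmorph_sum (eq_bigr X) => [|c _]; last by rewrite /= mevalXU.
  rewrite point_total => /eqP; rewrite mulf_eq0 expf_eq0 (negPf t_neq0) andbF.
  by move=> /eqP.
- rewrite -(mulfV t_neq0) -{1}point_total mulr_suml.
  by apply: eq_bigr => c _; rewrite mxE.
- by move=> c; rewrite mxE !mulf_neq0 ?invr_eq0.
- apply/colP => i; rewrite [RHS]mxE ![(_ *m _) i 0]mxE mulr_sumr.
  transitivity (\sum_c (row i A 0 c)%:CC * u 0 c).
    by apply: eq_bigr => c _; rewrite qi_mx_map [map_mx _ _ _ _]mxE [u^T _ _]mxE [row _ _ _ _]mxE.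
  rewrite -point_sub; last exact: submx_trans (row_sub _ _) A_sub_E.
  apply: eq_bigr => c _; rewrite -tpt qi_mx_map [map_mx _ _ _ _]mxE [pt^T _ _]mxE.
  by rewrite [row _ _ _ _]mxE mulrCA.
Qed.

Hypothesis M'x_neq0 : (Mu^`()).[x] != 0.

(** Write the specialized [M] as q times 'X - x. As the root is simple, [h], the value of q at [T],
    is a unit at the point, and M(T) in [J] gives T = x locally. Each coordinate is a polynomial in
    [T] modulo [J], hence locally constant. *)
Lemma point_multiplicity : has_multiplicity J pt 1.
Proof.
apply: reduced_multiplicity1; last by move=> f; apply: critical_ideal_vanish point_critical.
have /factor_theorem[q qE] := Mx.
have qx : q.[x] != 0.
  by move: M'x_neq0; rewrite qE derivM derivXsubC !hornerE subrr mulr0 add0r.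
have [J0 JD JM] := idJ.
pose T := dilate t Th; pose h := (map_poly (@mpolyC N C) q).[T].
have hp : h.@[pt 0] != 0.
  have TE : T.@[pt 0] = x.
    by rewrite /T meval_dilate (@meval_eq _ _ _ X) ?point_Th //; apply: tpt.
  rewrite -(horner_map (meval (pt 0))) -map_poly_comp /= TE.
  by rewrite (eq_map_poly (g := idfun)) ?map_poly_id // => a /=; rewrite mevalC.
have vJ f : vanish A f -> J (dilate t f).
  by move=> fA; apply: qi_ideal_sub; apply: (vanish_dilate j0).
have JT : J (h * (T - x%:MP)).
  have /vJ H : vanish A (evp M) by apply/kapP; rewrite kap_evp.
  have HT : (map_poly (@mpolyC N C) (map_poly psi M)).[T] = h * (T - x%:MP).
    rewrite (_ : map_poly psi M = q * ('X - x%:P)) //.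
    by rewrite rmorphM hornerM /= map_polyXsubC hornerXsubC.
  have := evp_cong M; rewrite HT; move: (dilate t (evp M)) H => dM H H'.
  by have := ideal_sub idJ H H'; rewrite opprB addrC subrK.
apply: (reduced_atP idJ hp) => c.
have idJ' := ideal_colon h idJ.
have H1 : J (h * ((map_poly (@mpolyC N C) (Qu c)).[T] - ((Qu c).[x])%:MP)).
  by rewrite -[X in _ - X](horner_map (@mpolyC N C)); apply: (ideal_cong_horner _ idJ').
have H2 : J ((psi D)%:MP * (t *: 'X_c) - (map_poly (@mpolyC N C) (Qu c)).[T]).
  have H : vanish A (pl D * 'X_c - evp (Q c)).
    by apply/kapP; rewrite rmorphB rmorphM -phiE DQ kap_evp subrr.
  have := vJ _ H; have := pl_cong D; have := evp_cong (Q c); rewrite -/T.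
  have dilateE F G : dilate t (F * 'X_c - G) = dilate t F * (t *: 'X_c) - dilate t G.
    by rewrite /dilate mmapB (rmorphM (mmap _ _)) /= mmapX mmap1U.
  rewrite dilateE; move: (dilate t (evp _)) (dilate t (pl _)) (_.[T]) => a b d Ja Jb Jab.
  have JX : J (t *: 'X_c - t *: 'X_c) by rewrite subrr.
  have := JD _ _ (ideal_sub idJ Jab (ideal_congM idJ Jb JX)) Ja.
  by congr J; ring.
have H3 := JD _ _ (JM h _ H2) H1.
have := JM ((psi D * t)^-1)%:MP _ H3; congr J.
have -> : (Qu c).[x] = psi D * t * pt 0 c by rewrite -mulrA tpt /X mulrCA divff // mulr1.
move: (_.[T]) => b; rewrite -mulrDr addrA subrK mulrCA; congr (_ * _).
rewrite -mul_mpolyC [(_ * pt 0 c)%:MP]mpolyCM mulrA -mpolyCM -mulrBr mulrA -mpolyCM.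
by rewrite mulVf ?mul1r // mulf_neq0.
Qed.

End Point.

Variables (U V : {poly {mpoly C[r]}}) (rho : {mpoly C[r]}).
Hypothesis M_sep : U * M + V * M^`() = rho%:P.
Hypothesis rho_neq0 : psi rho != 0.
Variables (UQ VQ : 'I_N -> {poly {mpoly C[r]}}) (rhoQ : 'I_N -> {mpoly C[r]}).
Hypothesis MQ_coprime : forall c, UQ c * M + VQ c * Q c = (rhoQ c)%:P.
Hypothesis rhoQ_neq0 : forall c, psi (rhoQ c) != 0.

(** Roots of the specialized [M] and critical points correspond by x -> Q(x) / (D t) and p -> Th(t
    p). Nonvanishing of [rho] makes the roots simple, that of [rhoQ c] makes the coordinate [c]
    nonzero at all of them. *)
Lemma fiber_count : exists (s : seq 'rV[C]_N) (mu : 'rV[C]_N -> nat),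
  [/\ uniq s, forall p, p \in s <-> critical u p,
      forall p, p \in s -> has_multiplicity J p (mu p)
    & (size M).-1 = (\sum_(p <- s) mu p)%N].
Proof.
have sizeMu : size Mu = size M by rewrite size_map_poly_id0.
have Mu0 : Mu != 0 by rewrite -size_poly_eq0 sizeMu size_poly_eq0.
have MuE : map_poly psi U * Mu + map_poly psi V * Mu^`() = (psi rho)%:P.
  have := congr1 (map_poly psi) M_sep.
  by rewrite rmorphD !(rmorphM (map_poly psi)) /= map_polyC -deriv_map.
have [rs [urs szrs rsE]] := separable_roots rho_neq0 MuE Mu0.
have Qx0 x : root Mu x -> forall c, (Qu c).[x] != 0.
  move=> /rootP Mx c; apply: contraNneq (rhoQ_neq0 c) => Qx.
  have := congr1 (fun G => (map_poly psi G).[x]) (MQ_coprime c).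
  rewrite /= rmorphD !(rmorphM (map_poly psi)) /= hornerD !hornerM map_polyC hornerC /= => <-.
  by rewrite -/Mu -/(Qu c) Mx Qx !mulr0 addr0.
have M'x0 x : root Mu x -> (Mu^`()).[x] != 0.
  move=> /rootP Mx; apply: contraNneq rho_neq0 => M'x.
  have := congr1 (horner^~ x) MuE.
  by rewrite /= hornerD !hornerM hornerC Mx M'x !mulr0 addr0 => <-.
exists [seq (\row_c ((Qu c).[x] / psi D / t)) | x <- rs], (fun=> 1%N); split.
- rewrite map_inj_in_uniq // => x x'; rewrite !rsE => Mx Mx' xx'.
  rewrite -(point_Th Mx) -(point_Th Mx'); apply: meval_eq => c.
  by have := congr1 (fun w : 'rV[C]_N => w 0 c) xx'; rewrite !mxE => /(mulIf _) ->; rewrite ?invr_eq0.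
- move=> p; split=> [/mapP[x xrs ->]|cp].
    by move: xrs; rewrite rsE => Mx; apply: point_critical => //; apply: Qx0.
  apply/mapP; exists Th.@[fun c => t * p 0 c]; first by rewrite rsE crit_root.
  apply/rowP => c; rewrite mxE -(crit_coord _ cp) [psi D * _]mulrC mulfK // mulrAC divff ?mul1r //.
- move=> _ /mapP[x xrs ->]; move: xrs; rewrite rsE => Mx.
  by apply: point_multiplicity => //; [apply: Qx0|apply: M'x0].
- by rewrite big_map big_const_seq count_predT iter_addn_0 mul1n szrs sizeMu.
Qed.

End Data.
End Fiber.

(** * Existence of the ML-degree *)

Section Existence.
Variables (R : realType) (k : nat) (n : 'I_k -> nat) (S : {set cells n}) (j0 : 'I_k).
Local Notation C := (complex R).
Local Notation N := #|S|.
Local Notation A := (qi_mx S R).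
Hypothesis N_gt0 : (0 < N)%N.

Let r := \rank A.
(** Independent rows of A_S itself are selected, so the exponents remain natural numbers. The cone
    then has as many parameters as b has independent coordinates, which is what
    [algebraic_dependence] asks for. *)
Let fr : 'I_r -> _ := maxrankfun A.
Let e : 'M[nat]_(r, N) := rowsub fr (qi_nat S).
Let P := mono R e.

Let rowsubE : rowsub fr A = natmx R e.
Proof. by apply/matrixP => i c; rewrite !mxE. Qed.

Let EA : (natmx R e :=: A)%MS.
Proof. by rewrite -rowsubE; apply: eq_maxrowsub. Qed.

Let E_free : row_free (1%:M *m natmx R e).
Proof. by rewrite mul1mx -rowsubE; apply: maxrowsub_free. Qed.

(* Opaque, for the same reason as [pull]. *)
Lemma kap_sig : {f : {rmorphism {mpoly C[N]} -> {mpoly C[r]}} | f =1 mmap (@mpolyC r C) P}.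
Proof. by exists (mmap (@mpolyC r C) P). Qed.

Let kap := sval kap_sig.
Let kapE : kap =1 mmap (@mpolyC r C) P := svalP kap_sig.

Let kapX c : kap 'X_c = P c.
Proof. by rewrite kapE mmapX mmap1U. Qed.

Let kapP f : vanish A f <-> kap f = 0.
Proof.
rewrite kapE; split=> [fA|/vanish_mono fE]; last exact: vanish_eqmx EA fE.
by apply/vanish_mono; apply: vanish_eqmx (eqmx_sym EA) fA.
Qed.

Let lin := linform (rowsub fr A) (fun c => 'X_c : {mpoly C[N]}).

Lemma pl_sig : {f : {rmorphism {mpoly C[r]} -> {mpoly C[N]}} | f =1 mmap (@mpolyC N C) lin}.
Proof. by exists (mmap (@mpolyC N C) lin). Qed.

Let pl := sval pl_sig.
Let plmE : pl =1 mmap (@mpolyC N C) lin := svalP pl_sig.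

Let plE f : pl f = pull A (mmap (@mpolyC _ C) (fun i => 'X_(fr i)) f).
Proof.
rewrite plmE pullE (rmorph_mmap _ (mmap (@mpolyC N C) _)).
apply: eq_mmap => [x|i] /=; first by rewrite mmapC.
rewrite mmapX mmap1U; apply: eq_bigr => c _.
by rewrite [rowsub _ _ _ _]mxE.
Qed.

Let plC x : pl x%:MP = x%:MP.
Proof. by rewrite plmE mmapC. Qed.

Let plX i : pl 'X_i = lin i.
Proof. by rewrite plmE mmapX mmap1U. Qed.

Lemma phi_sig : {f : {rmorphism {mpoly C[r]} -> {mpoly C[r]}} | forall x, f x = kap (pl x)}.
Proof. by exists (kap \o pl). Qed.

Let phi := sval phi_sig.
Let phiE : forall f, phi f = kap (pl f) := svalP phi_sig.

Let phiP f : phi f = mmap (@mpolyC r C) (linform (natmx R e) P) f.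
Proof. by rewrite phiE kapE plmE -mmap_pull pullE /lin -rowsubE. Qed.

Let phi_inj : injective phi.
Proof.
move=> f g fg; apply/eqP; rewrite -subr_eq0; apply/eqP.
apply: (linform_mono_inj E_free); rewrite mul1mx -[mono R e]/P -phiP rmorphB fg subrr //.
Qed.

Lemma ml_degree_exists :
  exists2 d, has_ml_degree R S d & ((d <= 1)%N -> rational_mle A).
Proof.
have char0 : [pchar {mpoly C[r]}] =i pred0.
  by apply/pcharf0P => -[|i]; [exact: eqxx|exact/negbTE/char0_mpoly].
have palg c : exists2 G : {poly {mpoly C[r]}}, G != 0 & (map_poly phi G).[kap 'X_c] = 0.
  have [G G0 GE] := algebraic_dependence (linform (natmx R e) P) (kap 'X_c).
  by exists G => //; rewrite -[RHS]GE; congr (_.[_]); apply: eq_map_poly => f; rewrite phiP.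
have [z [talg [D D0 [Q DQ]]]] := primitive_element_common phi_inj char0 palg.
set t := \sum_c _ in talg DQ.
have tE : t = kap (\sum_c 'X_c *~ z c).
  by rewrite rmorph_sum; apply: eq_bigr => c _; rewrite rmorphMz.
rewrite tE in talg DQ => {t tE}.
have [M [M0 Mt Mmin]] := minimal_poly_exists talg.
have [U [V [rho rho0 UV]]] := minimal_poly_bezout phi_inj M0 Mt Mmin
  (minimal_poly_deriv phi_inj M0 Mt Mmin char0).
have phi0 f : (phi f == 0) = (f == 0).
  by apply/eqP/eqP => [f0|->]; [apply: phi_inj; rewrite f0 rmorph0|exact: rmorph0].
(* The coordinate is a monomial on the cone, hence nonzero; so [Q c] is coprime to [M], and generic
   critical points avoid the coordinate hyperplanes. *)
have Qt c : (map_poly phi (Q c)).[kap (\sum_c 'X_c *~ z c)] != 0.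
  rewrite -DQ mulf_neq0 ?phi0 //.
  by rewrite kapX /P /mono -msize_poly_eq0 msizeX.
have /choice[UQ /choice[VQ /choice[rhoQ UVQ]]] : forall c, exists U V rho,
    rho != 0 /\ U * M + V * Q c = rho%:P.
  move=> c; have [U' [V' [rho' rho'0 E']]] := minimal_poly_bezout phi_inj M0 Mt Mmin (Qt c).
  by exists U', V', rho'.
(* The product of all conditions on b = A u. Its pullback to the data is nonzero because [phi] is
   injective. *)
pose hy := lead_coef M * D * rho * \prod_c rhoQ c.
have hy0 : hy != 0.
  rewrite !mulf_neq0 ?lead_coef_eq0 //; apply/prodf_neq0 => c _; exact: (UVQ c).1.
exists (size M).-1.
  exists (total_mpoly R S * pl hy).
    rewrite mulf_neq0 ?total_mpoly_neq0 //; apply: contraNneq hy0 => pl0.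
    by rewrite -phi0 phiE pl0 rmorph0.
  move=> u; rewrite mevalM meval_total mulf_eq0 negb_or => /andP[t0].
  have -> : (pl hy).@[u 0] = hy.@[fun i => (qi_mx S C *m u^T) (fr i) 0].
    rewrite plE meval_pull_data mmap_mpolyC_meval.
    by apply: meval_eq => i; rewrite mevalXU.
  rewrite /hy !mevalM !mulf_eq0 !negb_or rmorph_prod => /andP[/andP[/andP[lc0 Dy]] rhoy].
  move=> /prodf_neq0 rhoQy.
  have AE : (A <= rowsub fr A)%MS by rewrite rowsubE EA.
  apply: (fiber_count j0 N_gt0 AE kapP plE plC plX phiE M0 Mt Mmin DQ
    t0 lc0 Dy UV rhoy (fun c => (UVQ c).2)) => c.
  exact: rhoQy.
move=> d1; apply: rational_mle_eqmx EA _ => c.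
have [f [g [f0 fg]]] := minimal_poly_linear phi_inj M0 Mt d1 D0 (DQ c).
exists f, g; split.
  by move=> /vanish_pull; rewrite -[mono R e]/P -phiP => /eqP; rewrite phi0 (negPf f0).
apply/vanish_pullX; rewrite -[mono R e]/P -!phiP.
by rewrite -kapX.
Qed.

End Existence.

Local Open Scope nat_scope.

Theorem theorem6p3 (R : realType) (k : nat) (n : 'I_k -> nat)
    (S : {set cells n}) :
  (exists (a b : 'I_k)
     (i : forall j : {j : 'I_k | (j != a) && (j != b)}, 'I_(n (val j))),
     a != b /\ exists2 d : nat, has_ml_degree R (slice S i) d & 1 < d) ->
  exists2 d : nat, has_ml_degree R S d & 1 < d.
Proof.
move=> [a [b [i [_ [d' slice_deg d'1]]]]].
have not_rat : ~ rational_mle (qi_mx S R).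
  move=> /(rational_mle_slice (i := i))/(rational_mle_degree (ord0 : 'I_2)).
  by move=> /(_ d' slice_deg); rewrite leqNgt d'1.
(* Over an empty set of cells rationality holds vacuously. *)
have N0 : (0 < #|S|)%N.
  rewrite lt0n; apply/negP => /eqP N0; apply: not_rat => c.
  by have := ltn_ord c; rewrite {2}N0.
have [d Sdeg drat] := ml_degree_exists R a N0.
by exists d => //; rewrite ltnNge; apply/negP => /drat.
Qed.
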